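(* Let $q$ be a nonzero complex number with $|q|<1$. Let $t,m\in\mathbb{Z}$ with $t\geq 1$, $-t\leq m\leq 3t-2$ and $t\equiv m\pmod 2$. For generic $x$ (that is, $x\in\mathbb{C}\setminus\{0\}$ not an integral power of $q$), we have $$\mathcal{U}_{t}^{(m)}(x;q)=\frac{(1-x)}{\Theta(x;q)}\,\frac{q^{1-3t^2-\frac{t-m}{2}+tm}}{(q)_\infty^2}\sum_{k=0}^{4t^2-2}(-1)^{k+1}q^{\binom{k+1}{2}+k}\, f_{1,2t,1}\bigl(q^{2-4t^2+\frac{t+m}{2}+k},\,q^{1+\frac{t-m}{2}};q\bigr)\, f_{1,4t^2-1,4t^2(4t^2-1)}\bigl(x^{-1}q^{k+1},\,-q^{4t^2k-t^2+tm-\frac{t-m}{2}+8t^4};q\bigr).$$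
   Context: Notation: $(a)_n=(a;q)_n=\prod_{k=1}^{n}(1-aq^{k-1})$ for $n\in\mathbb{N}\cup\{\infty\}$; in particular $(q)_\infty=\prod_{k\ge1}(1-q^k)$. The theta function is $\Theta(x;q)=(x)_\infty(q/x)_\infty(q)_\infty=\sum_{n\in\mathbb{Z}}(-1)^nq^{\binom n2}x^n$. Set $\mathrm{sg}(r)=1$ if $r\ge0$ and $\mathrm{sg}(r)=-1$ if $r<0$, and $\mathrm{sg}(r,s)=\frac{\mathrm{sg}(r)+\mathrm{sg}(s)}{2}$. For positive integers $a,b,c$ the Hecke-type double sum is $$f_{a,b,c}(x,y;q)=\sum_{r,s\in\mathbb{Z}}\mathrm{sg}(r,s)(-1)^{r+s}x^ry^sq^{a\binom r2+brs+c\binom s2}.$$ Here $\binom{n}{2}=n(n-1)/2$ for every integer $n$. Define $$g_{t,m}(x;q)=\left(\sum_{r,s\ge0}-\sum_{r,s<0}\right)\frac{(-1)^{r+s}q^{\frac{r^2}{2}+2trs+\frac{s^2}{2}+\frac{t+1+m}{2}r+\frac{t+1-m}{2}s}}{1-xq^r},\qquad \mathcal{U}_t^{(m)}(x;q)=\frac{(1-x)}{(q)_\infty^2}\,g_{t,m}(x;q).$$ *)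

(* Defs.v *)
From mathcomp Require Import all_boot all_order all_algebra.
From mathcomp Require Import complex.
From mathcomp Require Import reals topology normedtype.
From mathcomp.analysis Require showcase.summability.

Set Implicit Arguments.
Unset Strict Implicit.
Unset Printing Implicit Defensive.

Import Order.TTheory GRing.Theory Num.Theory.
Import numFieldNormedType.Exports.

Local Open Scope classical_set_scope.
Local Open Scope ring_scope.

(* The limits below are taken in [R[i]^o], because the norm topology of a
   [numFieldType] such as [R[i]] is attached to its regular module.  Both [lim]
   and [summability.sum] are total, with an unspecified value in case of
   divergence; for 0 < |q| < 1 all the infinite products below converge, and
   so do (absolutely) all the double sums below for nonzero arguments
   (and x not a power of q, for those with a denominator 1 - x q^r). *)

(* (a; q)_oo *)
Definition qpoch_inf (R : realType) (a q : R[i]) : R[i] :=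
  lim ((fun n : nat => \prod_(0 <= k < n) (1 - a * q ^+ k) : R[i]^o) @ \oo).

Definition Theta (R : realType) (x q : R[i]) : R[i] :=
  qpoch_inf x q * qpoch_inf (q / x) q * qpoch_inf q q.

(* [summability.sum] is the limit of the finite partial sums along the finite
   subsets of the index type ordered by inclusion (unordered summation). *)
Definition sum_ZZ (R : realType) (u : int -> int -> R[i]) : R[i] :=
  summability.sum (fun p : int * int => u p.1 p.2 : R[i]^o).

Definition sg (r : int) : int := if 0 <= r then 1 else -1.

Definition sg2 (R : realType) (r s : int) : R[i] := (sg r + sg s)%:~R / 2.

(* binomial coefficient (n choose 2) for n in Z; n (n - 1) is always even *)
Definition binz2 (n : int) : int := (n * (n - 1) %/ 2)%Z.

Definition hecke_f (R : realType) (a b c : int) (x y q : R[i]) : R[i] :=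
  sum_ZZ (fun r s => sg2 R r s * (-1) ^ (r + s) * x ^ r * y ^ s
                     * q ^ (a * binz2 r + b * r * s + c * binz2 s)).

(* r^2/2 + 2trs + s^2/2 + (t+1+m)/2 r + (t+1-m)/2 s; the division by 2 is exact
   when t and m have the same parity, the only case in which it is used. *)
Definition g_expo (t m r s : int) : int :=
  ((r ^+ 2 + 4 * t * r * s + s ^+ 2 + (t + 1 + m) * r + (t + 1 - m) * s)
     %/ 2)%Z.

Definition g_term (R : realType) (t m : int) (x q : R[i]) (r s : int) : R[i] :=
  (-1) ^ (r + s) * q ^ g_expo t m r s / (1 - x * q ^ r).

Definition hecke_g (R : realType) (t m : int) (x q : R[i]) : R[i] :=
  sum_ZZ (fun r s => if (0 <= r) && (0 <= s) then g_term t m x q r s else 0)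
  - sum_ZZ (fun r s => if (r < 0) && (s < 0) then g_term t m x q r s else 0).

Definition calU (R : realType) (t m : int) (x q : R[i]) : R[i] :=
  (1 - x) / qpoch_inf q q ^+ 2 * hecke_g t m x q.

(* Main.v *)
(** Multiplying g_{t,m}(x; q) by Theta(x; q) removes its poles: shifting the indices of summation
    shows that f_{1,1,1}(q/x, q^{1+r}) = Theta(x; q) / (1 - x q^r). Hence Theta g is an absolutely
    convergent sum over Z^4 whose general term is a product of two Hecke-type terms, in (r, s) and
    in (r', j), coupled by q^{rj}; the bounds on m are what makes it converge. Summing over (r, s)
    first gives the values F(j) = f_{1,2t,1}(q^{1+(t+m)/2+j}, q^{1+(t-m)/2}). The boundary terms
    of the functional equation of f_{1,2t,1} are theta values at integral powers of q, which
    vanish, so F is quasi-periodic with period 4t^2 - 1; writing j = k + (4t^2 - 1) s' and summing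
    over (r', s') for fixed k gives the second factor f_{1,4t^2-1,4t^2(4t^2-1)}. *)
Require Import Defs.
From mathcomp Require Import all_boot all_order all_algebra.
From mathcomp Require Import complex finmap.
From mathcomp Require Import boolp classical_sets reals topology normedtype sequences.
From mathcomp Require Import ring lra zify.
From mathcomp.analysis Require showcase.summability.

Set Implicit Arguments.
Unset Strict Implicit.
Unset Printing Implicit Defensive.

Import Order.TTheory GRing.Theory Num.Theory.
Import numFieldNormedType.Exports.

Local Open Scope fset_scope.
Local Open Scope ring_scope.

(** * Unordered sums *)

(** Shifting the indices of f_{1,2t,1} by (i, j) multiplies its arguments by q^(i + 2tj) and q^(2ti
    + j). The second is fixed exactly for j = - 2ti, and the first then gains q^((1 - 4t^2) i):
    hence the period M = 4t^2 - 1. In the last factor, the coefficient M of r's' comes from r'j with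
    j = k + M s', and 4t^2 M = M^2 + M, with M^2 from binom(j, 2) and M from the factor of
    quasi-periodicity. The obstacle is the interchange of sums: the quadratic form is indefinite,
    and even on the quadrants selected by the signs the coupling rj can be negative. An explicit
    lower bound of the four-variable exponent, [quadruple_exponent], settles it. Since [Theta] is
    given as a product while f_{1,1,1} yields its series, the triple product is proved on the
    way. *)

Lemma sum_fset_if (K : nmodType) (I : choiceType) (u : I -> K) (A B : {fset I}) :
  A `<=` B -> \sum_(i <- B) (if i \in A then u i else 0) = \sum_(i <- A) u i.
Proof.
move=> sAB; rewrite -(@big_fset_incl _ _ _ _ A B) //; last by move=> i _ /negbTE ->.
by rewrite big_seq [RHS]big_seq; apply: eq_bigr => i ->.
Qed.

Section UnorderedSums.
Variable K : numFieldType.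

(** Explicit epsilons keep every rearrangement a statement about sums that exist; the total operator
    [summability.sum] is reached only through [has_sum_sum]. *)
Definition has_sum (I : choiceType) (u : I -> K) (l : K) :=
  forall e, 0 < e -> exists J : {fset I},
    forall J' : {fset I}, J `<=` J' -> `|\sum_(i <- J') u i - l| < e.

(** In the partial order of [R[i]], the empty [J] already forces [M] to be a nonnegative real. *)
Definition abs_summable (I : choiceType) (u : I -> K) :=
  exists M : K, forall J : {fset I}, \sum_(i <- J) `|u i| <= M.

Lemma has_sum_unique (I : choiceType) (u : I -> K) l1 l2 :
  has_sum u l1 -> has_sum u l2 -> l1 = l2.
Proof.
move=> h1 h2; apply/eqP; rewrite -subr_eq0 -normr_eq0; apply: contraT => h.
have e0 : 0 < `|l1 - l2| / 2 by rewrite divr_gt0 // lt_def h /=.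
have [J1 H1] := h1 _ e0; have [J2 H2] := h2 _ e0.
have := ltrD (H1 _ (fsubsetUl J1 J2)) (H2 _ (fsubsetUr J1 J2)).
rewrite -splitr; set S := \sum_(i <- _) _.
have -> : l1 - l2 = (S - l2) - (S - l1) by ring.
by rewrite addrC => /(le_lt_trans (ler_normB _ _)); rewrite ltxx.
Qed.

Lemma eq_has_sum (I : choiceType) (u v : I -> K) l :
  u =1 v -> has_sum u l -> has_sum v l.
Proof. by move=> /funext ->. Qed.

Lemma has_sumD (I : choiceType) (u v : I -> K) l1 l2 :
  has_sum u l1 -> has_sum v l2 -> has_sum (fun i => u i + v i) (l1 + l2).
Proof.
move=> h1 h2 e e0.
have e2 : 0 < e / 2 by rewrite divr_gt0.
have [J1 H1] := h1 _ e2; have [J2 H2] := h2 _ e2.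
exists (J1 `|` J2) => J; rewrite fsubUset => /andP[s1 s2].
rewrite big_split /= opprD addrACA [e]splitr.
by apply: le_lt_trans (ler_normD _ _) (ltrD (H1 _ s1) (H2 _ s2)).
Qed.

Lemma has_sum0 (I : choiceType) : has_sum (fun _ : I => 0) 0.
Proof.
by move=> e e0; exists fset0 => J _; rewrite big1 // subrr normr0.
Qed.

Lemma has_sumZ (I : choiceType) (u : I -> K) c l :
  has_sum u l -> has_sum (fun i => c * u i) (c * l).
Proof.
have [-> _|c0 h e e0] := eqVneq c 0.
  by rewrite mul0r; apply: eq_has_sum (@has_sum0 I) => i; rewrite mul0r.
have [J H] := h (e / `|c|) ltac:(by rewrite divr_gt0 // normr_gt0).
exists J => J' /H; rewrite -mulr_sumr -mulrBr normrM.
by rewrite ltr_pdivlMr ?normr_gt0 // mulrC.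
Qed.

Lemma has_sumB (I : choiceType) (u v : I -> K) l1 l2 :
  has_sum u l1 -> has_sum v l2 -> has_sum (fun i => u i - v i) (l1 - l2).
Proof.
move=> h1 /(has_sumZ (-1)) h2; rewrite -[- l2]mulN1r.
by apply: eq_has_sum (has_sumD h1 h2) => i; rewrite mulN1r.
Qed.

Lemma has_sum_bij (I J : choiceType) (f : I -> J) (g : J -> I) (u : J -> K) l :
  cancel f g -> cancel g f -> has_sum u l -> has_sum (u \o f) l.
Proof.
move=> fg gf h e e0; have [A H] := h e e0.
exists (g @` A) => B sAB.
have -> : \sum_(i <- B) (u \o f) i = \sum_(j <- f @` B) u j.
  by rewrite big_imfset //= => x y _ _; apply: (can_inj fg).
apply: H; apply/fsubsetP => j jA; rewrite -[j]gf; apply/imfsetP; exists (g j) => //.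
by move/fsubsetP: sAB; apply; apply/imfsetP; exists j.
Qed.

Lemma has_sum_fin (I : finType) (u : I -> K) : has_sum u (\sum_i u i).
Proof.
move=> e e0; exists [fset i | i in I] => J sJ.
suff -> : \sum_(i <- J) u i = \sum_i u i by rewrite subrr normr0.
apply: perm_big; apply: uniq_perm; rewrite ?fset_uniq ?index_enum_uniq //.
move=> i; rewrite mem_index_enum; apply: (fsubsetP sJ).
by apply/imfsetP; exists i.
Qed.

Lemma has_sum_single (I : choiceType) (u : I -> K) (i0 : I) :
  (forall i, i != i0 -> u i = 0) -> has_sum u (u i0).
Proof.
move=> h e e0; exists [fset i0] => J sJ.
suff -> : \sum_(i <- J) u i = u i0 by rewrite subrr normr0.
rewrite -(@big_fset_incl _ _ _ _ [fset i0] J) ?big_seq_fset1 //.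
by move=> i _; rewrite inE => /h.
Qed.

Lemma big_fsetM (I J : choiceType) (A : {fset I}) (B : {fset J}) (u : I * J -> K) :
  \sum_(p <- A `*` B) u p = \sum_(i <- A) \sum_(j <- B) u (i, j).
Proof.
rewrite -big_allpairs.
apply: perm_big; apply: uniq_perm; rewrite ?fset_uniq ?allpairs_uniq ?fset_uniq //.
  by case=> ? ? [? ?].
case=> i j; rewrite in_fsetM /=; apply/andP/allpairsP => [[iA jB]|].
  by exists (i, j).
by case=> -[i' j'] /= [iA jB [-> ->]].
Qed.

Lemma has_sum_uniform (I J : choiceType) (u : I -> J -> K) (r : I -> K) (s : seq I) d :
  (forall i, has_sum (u i) (r i)) -> 0 < d ->
  exists B : {fset J}, forall B' : {fset J}, B `<=` B' ->
    forall i, i \in s -> `|\sum_(j <- B') u i j - r i| < d.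
Proof.
move=> h d0; elim: s => [|i s [B1 H1]]; first by exists fset0.
have [B2 H2] := h i _ d0.
exists (B1 `|` B2) => B; rewrite fsubUset => /andP[s1 s2] k.
by rewrite inE => /orP[/eqP->|/H1]; [exact: H2 | exact].
Qed.

(** A finite set of rows is completed to a rectangle that contains the [A] of the double sum and
    whose columns nearly exhaust each of these rows. *)
Lemma has_sum_rows (I J : choiceType) (u : I * J -> K) (r : I -> K) l :
  has_sum u l -> (forall i, has_sum (fun j => u (i, j)) (r i)) -> has_sum r l.
Proof.
move=> h hr e e0.
have e2 : 0 < e / 2 by rewrite divr_gt0.
have [A HA] := h _ e2.
exists (fst @` A) => B sAB.
(* The successor keeps [d] positive when [B] is empty. *)
pose d := e / 2 / (size B).+1%:R.
have d0 : 0 < d by rewrite divr_gt0.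
have [C HC] := has_sum_uniform B hr d0.
have sA : A `<=` B `*` (C `|` snd @` A).
  apply/fsubsetP => p pA; rewrite in_fsetM; apply/andP; split.
    by apply: (fsubsetP sAB); apply/imfsetP; exists p.
  by rewrite inE; apply/orP; right; apply/imfsetP; exists p.
have := HA _ sA; rewrite big_fsetM => h1.
rewrite -[r in \sum_(i <- _) r i]/(fun i => r i).
have -> : \sum_(i <- B) r i - l =
  (\sum_(i <- B) \sum_(j <- C `|` snd @` A) u (i, j) - l)
   - \sum_(i <- B) (\sum_(j <- C `|` snd @` A) u (i, j) - r i).
  by rewrite sumrB; ring.
apply: le_lt_trans (ler_normB _ _) _; rewrite [e]splitr.
apply: ltr_leD h1 _; apply: le_trans (ler_norm_sum _ _ _) _.
apply: (@le_trans _ _ (\sum_(i <- B) d)).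
  rewrite big_seq [X in _ <= X]big_seq; apply: ler_sum => i iB; apply/ltW.
  by apply: HC => //; apply: fsubsetUl.
have -> : e / 2 = d * (size B).+1%:R by rewrite /d mulfVK // pnatr_eq0.
by rewrite big_const_seq count_predT iter_addr_0 -[X in X <= _]mulr_natr ler_pM2l // ler_nat.
Qed.

Lemma ler_sum_fset (I : choiceType) (u : I -> K) (A B : {fset I}) :
  A `<=` B -> \sum_(i <- A) `|u i| <= \sum_(i <- B) `|u i|.
Proof.
move=> sAB; rewrite -(sum_fset_if _ sAB).
by apply: ler_sum => i _; case: ifP.
Qed.

Lemma abs_summable_le (I : choiceType) (u v : I -> K) :
  (forall i, `|u i| <= `|v i|) -> abs_summable v -> abs_summable u.
Proof. by move=> h [M HM]; exists M => J; apply: le_trans (HM J); apply: ler_sum. Qed.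

Lemma abs_summable_inj (I J : choiceType) (f : I -> J) (u : J -> K) :
  injective f -> abs_summable u -> abs_summable (u \o f).
Proof.
move=> fi [M HM]; exists M => B; apply: le_trans (HM (f @` B)).
by rewrite big_imfset //= => x y _ _; apply: fi.
Qed.

Lemma abs_summableD (I : choiceType) (u v : I -> K) :
  abs_summable u -> abs_summable v -> abs_summable (fun i => u i + v i).
Proof.
move=> [M HM] [N HN]; exists (M + N) => J; apply: le_trans (lerD (HM J) (HN J)).
by rewrite -big_split; apply: ler_sum => i _; apply: ler_normD.
Qed.

Lemma abs_summableZ (I : choiceType) (u : I -> K) c :
  abs_summable u -> abs_summable (fun i => c * u i).
Proof.
move=> [M HM]; exists (`|c| * M) => J.
under eq_bigr do rewrite normrM.
by rewrite -mulr_sumr ler_wpM2l.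
Qed.

Lemma abs_summableB (I : choiceType) (u v : I -> K) :
  abs_summable u -> abs_summable v -> abs_summable (fun i => u i - v i).
Proof.
move=> hu hv; have := abs_summableD hu (abs_summableZ (-1) hv).
by apply: abs_summable_le => i; rewrite mulN1r.
Qed.

Lemma abs_summableM (I J : choiceType) (u : I -> K) (v : J -> K) :
  abs_summable u -> abs_summable v ->
  abs_summable (fun p : I * J => u p.1 * v p.2).
Proof.
move=> [M HM] [N HN]; exists (M * N) => A.
have sA : A `<=` fst @` A `*` (snd @` A).
  apply/fsubsetP => p pA; rewrite in_fsetM.
  by apply/andP; split; apply/imfsetP; exists p.
apply: le_trans (ler_sum_fset _ sA) _; rewrite big_fsetM /=.
under eq_bigr => i _ do (under eq_bigr => j _ do rewrite normrM).
under eq_bigr => i _ do rewrite -mulr_sumr.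
rewrite -mulr_suml ler_pM ?sumr_ge0 //.
Qed.

End UnorderedSums.

(** * From absolute summability to sums, over the reals and the complex numbers *)

Lemma has_sum_nneg (R : realType) (I : choiceType) (u : I -> R) :
  (forall i, 0 <= u i) -> abs_summable u -> exists l, has_sum u l.
Proof.
move=> u0 [M HM].
pose S : set R := [set y | exists J : {fset I}, y = \sum_(i <- J) u i]%classic.
have uE J : \sum_(i <- J) u i = \sum_(i <- J) `|u i|.
  by apply: eq_bigr => i _; rewrite ger0_norm.
have hS : has_sup S.
  split; first by exists (\sum_(i <- fset0) u i); exists fset0.
  by exists M => _ [J ->]; rewrite uE.
exists (sup S) => e e0.
have [_ [J ->] HJ] := sup_adherent e0 hS.
exists J => J' sJ.
have h1 : \sum_(i <- J) u i <= \sum_(i <- J') u i by rewrite !uE ler_sum_fset.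
have h2 : \sum_(i <- J') u i <= sup S by apply: (ub_le_sup hS.2); exists J'.
rewrite ler0_norm ?subr_le0 //; lra.
Qed.

(** Write u as (|u| + u) - |u|, a difference of nonnegative families. *)
Lemma has_sum_real (R : realType) (I : choiceType) (u : I -> R) :
  abs_summable u -> exists l, has_sum u l.
Proof.
move=> hu.
have ha : abs_summable (fun i => `|u i|).
  by apply: abs_summable_le hu => i; rewrite normr_id.
have [l1 h1] : exists l, has_sum (fun i => `|u i| + u i) l.
  apply: has_sum_nneg; last exact: abs_summableD.
  by move=> i; have := lerNnormlW (lexx (`|u i|)); lra.
have [l2 h2] := has_sum_nneg (fun i => normr_ge0 (u i)) ha.
exists (l1 - l2); apply: eq_has_sum (has_sumB h1 h2) => i; ring.
Qed.

Section Complex.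
Variable R : realType.
Local Notation C := R[i].

Lemma has_sum_complex (I : choiceType) (u : I -> R) l :
  has_sum u l -> has_sum (fun i => (u i)%:C%C : C) (l%:C%C).
Proof.
move=> h e e0.
have eE : e = (complex.Re e)%:C%C.
  by apply/eqP; rewrite eq_complex /= eqxx /= (ger0_Im (ltW e0)).
have [J H] := h (complex.Re e) ltac:(by rewrite -ltcR -eE).
exists J => J' /H; rewrite eE -ltcR; congr (_ < _).
by rewrite -rmorph_sum -rmorphB /= normc_def /= expr0n /= addr0 sqrtr_sqr.
Qed.

Lemma abs_summable_has_sum (I : choiceType) (u : I -> C) :
  abs_summable u -> exists l, has_sum u l.
Proof.
have key (v : I -> C) : abs_summable v -> exists l, has_sum (fun i => complex.Re (v i)) l.
  move=> [M HM]; apply: has_sum_real; exists (complex.Re M) => J.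
  have : (\sum_(i <- J) `|complex.Re (v i)|)%:C%C <= M.
    rewrite rmorph_sum; apply: le_trans (HM J); apply: ler_sum => i _.
    exact: normc_ge_Re.
  by rewrite lecE /= => /andP[].
(* The imaginary part of u is minus the real part of i u, so [key] serves twice. *)
move=> hu; have [a ha] := key _ hu; have [b hb] := key _ (abs_summableZ 'i%C hu).
exists (a%:C%C - 'i%C * b%:C%C).
apply: eq_has_sum (has_sumB (has_sum_complex ha) (has_sumZ 'i%C (has_sum_complex hb))) => i.
have -> : complex.Re ('i%C * u i) = - complex.Im (u i) by rewrite mulrC ReiNIm.
by rewrite [RHS]complexE rmorphN /= mulrN opprK.
Qed.

Lemma has_sum_sum (I : choiceType) (u : I -> C) l :
  has_sum u l -> summability.sum (u : I -> C^o) = l.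
Proof.
move=> h; have F := @summability.totally_filter I.
apply: cvg_lim; first exact: norm_hausdorff.
apply/cvgrPdist_lt => e e0; have [J H] := h e e0.
exists J => // J' /H; rewrite distrC /summability.partial_sum.
by rewrite (big_seq_fsetE _ J' xpredT u).
Qed.

End Complex.

(** * Integer powers, geometric and Gaussian majorants *)

Lemma binz2E (n : int) : 2 * binz2 n = n * (n - 1).
Proof.
rewrite /binz2 mulrC divzK // dvdzE abszM dvdn2 oddM; lia.
Qed.

Lemma normfXz (K : numFieldType) (y : K) (n : int) : `|y ^ n| = `|y| ^ n.
Proof. by case: n => n; rewrite ?NegzE -?exprz_inv -!exprnP normrX ?normfV. Qed.

Lemma ler_iXz2l (K : numFieldType) (h : K) (m n : int) :
  0 < h -> h <= 1 -> m <= n -> h ^ n <= h ^ m.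
Proof.
move=> h0 h1 mn; have -> : n = m + (n - m) by ring.
rewrite expfzDr ?gt_eqF // ler_piMr ?exprz_ge0 //; first exact: ltW.
have -> : n - m = `|n - m|%N by lia.
by rewrite -exprnP exprn_ile1 // ltW.
Qed.

Lemma geometric_sum_le (K : numFieldType) (h : K) (J : {fset nat}) :
  0 <= h -> h < 1 -> \sum_(i <- J) h ^+ i <= (1 - h)^-1.
Proof.
move=> h0 h1.
have d0 : 0 < 1 - h by rewrite subr_gt0.
pose N := (\max_(i <- J) i).+1.
have sJ : {subset J <= iota 0 N}.
  by move=> i iJ; rewrite mem_iota /= add0n ltnS; apply: leq_bigmax_seq.
apply: (@le_trans _ _ (\sum_(i < N) h ^+ i)); last first.
  rewrite -(ler_pM2l d0) divff ?gt_eqF // -opprB mulNr -subrX1 opprB.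
  by rewrite lerBlDr lerDl exprn_ge0.
rewrite -(big_mkord xpredT (fun i => h ^+ i)) [X in _ <= X](bigID (mem J)) /=.
have -> : \sum_(i <- J) h ^+ i = \sum_(0 <= i < N | i \in J) h ^+ i.
  rewrite -[RHS]big_filter; apply: perm_big.
  apply: uniq_perm; rewrite ?filter_uniq ?iota_uniq ?fset_uniq //.
  by move=> i; rewrite mem_filter /index_iota subn0; case: (boolP (i \in J)) => // /sJ ->.
by rewrite lerDl sumr_ge0 // => i _; rewrite exprn_ge0.
Qed.

Lemma abs_summable_geometric (K : numFieldType) (h : K) :
  0 <= h -> h < 1 -> abs_summable (fun n : int => h ^+ `|n|%N).
Proof.
move=> h0 h1; exists ((1 - h)^-1 + (1 - h)^-1) => J.
(* [absz] is injective on each half-line, so each half of [J] is bounded by one geometric series. *)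
rewrite (big_fsetID _ (fun n : int => 0 <= n)) /=.
have bound (A : {fset int}) : {in A &, injective absz} ->
    \sum_(i <- A) `|h ^+ `|i|%N| <= (1 - h)^-1.
  move=> Ai; under eq_bigr do rewrite ger0_norm ?exprn_ge0 //.
  by have := geometric_sum_le (absz @` A) h0 h1; rewrite big_imfset.
by apply: lerD; apply: bound => i j; rewrite !inE /= => /andP[_ a] /andP[_ b]; lia.
Qed.

Section Gauss.
Variable R : realType.
Local Notation C := R[i].

Lemma exprC_small (h e : C) : 0 <= h -> h < 1 -> 0 < e -> exists n, h ^+ n < e.
Proof.
have re (z : C) : 0 <= z -> exists a : R, z = a%:C%C.
  by move=> z0; exists (complex.Re z); apply/eqP; rewrite eq_complex /= eqxx /= ger0_Im.
move=> h0 h1 e0; have [a aE] := re _ h0; have [b bE] := re _ (ltW e0).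
move: h0 h1 e0; rewrite {}aE {}bE {h e}; move: a b => h e.
rewrite ler0c -[1]/(1%:C%C) -[X in X < e%:C%C]/(0%:C%C) !ltcR => h0 h1 e0.
have /cvgrPdist_lt/(_ _ e0)[N _ /(_ N (leqnn _))] := cvg_expr (z := h) ltac:(by rewrite ger0_norm).
rewrite /= sub0r normrN ger0_norm ?exprn_ge0 // => hN.
by exists N; rewrite -rmorphXn ltcR.
Qed.

Variables (q : C).
Hypotheses (q0 : q != 0) (q1 : `|q| < 1).

(** Measuring y^n in powers of |q| turns the domination of the Gaussian series into an inequality
    between integer exponents. *)
Lemma normXz_le (y : C) : y != 0 ->
  exists A : nat, forall n : int, `|y ^ n| <= `|q| ^ (- (A%:Z * `|n|)).
Proof.
move=> y0; have h0 : 0 < `|q| by rewrite normr_gt0.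
have [A1 HA1] := exprC_small (ltW h0) q1 (e := `|y^-1|) ltac:(by rewrite normr_gt0 invr_eq0).
have [A2 HA2] := exprC_small (ltW h0) q1 (e := `|y|) ltac:(by rewrite normr_gt0).
have key (z : C) (A : nat) (n : nat) : z != 0 -> `|q| ^+ A < `|z^-1| -> (A <= A1 + A2)%N ->
    `|z| ^+ n <= `|q| ^ (- ((A1 + A2)%N%:Z * n)).
  move=> z0 hA AA; have h : `|z| <= `|q| ^- A.
    by rewrite -[X in X <= _]invrK lef_pV2 ?posrE ?invr_gt0 ?normr_gt0 ?exprn_gt0 // -normfV ltW.
  apply: (@le_trans _ _ (`|q| ^- A ^+ n)).
    by rewrite lerXn2r ?nnegrE ?invr_ge0 ?exprn_ge0.
  rewrite -exprVn -exprM exprnP exprz_inv; apply: ler_iXz2l => //; first exact: ltW.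
  by nia.
exists (A1 + A2)%N => n; rewrite normfXz; case: n => n.
  by rewrite -exprnP; apply: (key y A1) => //; rewrite leq_addr.
rewrite NegzE -exprz_inv -exprnP -normfV normrN.
have := key y^-1 A2 n.+1; rewrite invrK invr_eq0; apply => //; exact: leq_addl.
Qed.

Lemma abs_summable_gauss (y : C) : y != 0 ->
  abs_summable (fun n : int => q ^ binz2 n * y ^ n).
Proof.
move=> y0; have [A HA] := normXz_le y0.
have h0 : 0 < `|q| by rewrite normr_gt0.
(* With N = |n|, [binz2 n] - A N - N is at least (N^2 - (2A + 3) N) / 2, hence at least - (2A + 3)^2
   / 8; the constant leaves ample room. *)
have := abs_summableZ (`|q| ^ (- ((2 * A%:Z + 3) ^+ 2)))
  (abs_summable_geometric (ltW h0) q1).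
apply: abs_summable_le => n.
rewrite !normrM normfXz [X in _ <= X * _]ger0_norm ?exprz_ge0 //.
rewrite [X in _ <= _ * X]ger0_norm ?exprn_ge0 // [X in _ <= _ * X]exprnP -expfzDr ?gt_eqF //.
apply: le_trans (ler_wpM2l _ (HA n)) _; first exact: exprz_ge0.
rewrite -expfzDr ?gt_eqF //; apply: ler_iXz2l => //; first exact: ltW.
by have := binz2E n; nia.
Qed.

End Gauss.

(** * Hecke-type double sums *)

Lemma binz2D (m n : int) : binz2 (m + n) = binz2 m + binz2 n + m * n.
Proof. by apply: (@mulfI _ (2 : int)) => //; rewrite !mulrDr !binz2E; ring. Qed.

Lemma binz2N (n : int) : binz2 (- n) = binz2 n + n.
Proof. by apply: (@mulfI _ (2 : int)) => //; rewrite !mulrDr !binz2E; ring. Qed.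

Lemma exprN1_even (K : fieldType) (m n : int) : (-1 : K) ^ (m + 2 * n) = (-1) ^ m.
Proof. by rewrite expfzDr ?oppr_eq0 ?oner_eq0 // -exprz_exp -exprnP sqrrN expr1n exp1rz mulr1. Qed.

(** The term of [hecke_f] without its sign: index shifts act exactly on this part, while the sign
    changes along a few lines. *)
Definition hecke_mono (K : fieldType) (a b c : int) (x y q : K) (r s : int) : K :=
  (-1) ^ (r + s) * x ^ r * y ^ s * q ^ (a * binz2 r + b * r * s + c * binz2 s).

Lemma hecke_monoC (K : fieldType) a b c (x y q : K) r s :
  hecke_mono a b c x y q r s = hecke_mono c b a y x q s r.
Proof.
rewrite /hecke_mono [s + r]addrC -!mulrA; congr (_ * _); rewrite !mulrA [y ^ s * _]mulrC.
by congr (_ * q ^ _); ring.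
Qed.

(** The exponent is quadratic, so the cross terms between (r, s) and (i, j) are linear in (r, s) and
    can be absorbed into the two arguments. *)
Lemma hecke_mono_shift (K : fieldType) a b c (x y q : K) r s i j :
  x != 0 -> y != 0 -> q != 0 ->
  hecke_mono a b c x y q (r + i) (s + j) =
  hecke_mono a b c x y q i j *
    hecke_mono a b c (x * q ^ (a * i + b * j)) (y * q ^ (b * i + c * j)) q r s.
Proof.
move=> x0 y0 q0; rewrite /hecke_mono !binz2D.
have -> : r + i + (s + j) = (r + s) + (i + j) by ring.
rewrite !expfzMl !exprz_exp (expfzDr (r + s)) ?oppr_eq0 ?oner_eq0 //.
rewrite (expfzDr r i x0) (expfzDr s j y0).
have -> : a * (binz2 r + binz2 i + r * i) + b * (r + i) * (s + j) +
  c * (binz2 s + binz2 j + s * j) = (a * binz2 i + b * i * j + c * binz2 j)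
  + ((a * i + b * j) * r + ((b * i + c * j) * s + (a * binz2 r + b * r * s + c * binz2 s))).
  by ring.
by rewrite !(expfzDr _ _ q0); ring.
Qed.

Section HeckeSums.
Variable R : realType.
Local Notation C := R[i].
Local Notation sg2 := (@sg2 R).

Lemma sg2E (r s : int) : sg2 r s =
  if (0 <= r) && (0 <= s) then 1 else if (r < 0) && (s < 0) then -1 else 0.
Proof.
rewrite /Defs.sg2 /sg; case: (leP 0 r) => _; case: (leP 0 s) => _ /=.
- by rewrite (_ : (1 + 1)%:~R = 2 :> C) // divff ?pnatr_eq0.
- by rewrite subrr mul0r.
- by rewrite addNr mul0r.
- by rewrite (_ : (-1 - 1)%:~R = - 2 :> C) // mulNr divff ?pnatr_eq0.
Qed.

Lemma sg2_nneg (r s : int) : 0 <= r -> 0 <= s -> sg2 r s = 1.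
Proof. by move=> r0 s0; rewrite sg2E r0 s0. Qed.

Lemma sg2_neg (r s : int) : r < 0 -> s < 0 -> sg2 r s = -1.
Proof. by move=> r0 s0; rewrite sg2E leNgt r0 s0. Qed.

Lemma sg2_mixed (r s : int) : (0 <= r) != (0 <= s) -> sg2 r s = 0.
Proof. by rewrite sg2E !ltNge; case: (0 <= r); case: (0 <= s). Qed.

(** Since [sg2] is a function of r plus a function of s, its variation splits into a part supported
    on finitely many values of r and a part supported on finitely many values of s. *)
Lemma sg2_shift (r s i j : int) : sg2 (r + i) (s + j) - sg2 r s =
  (sg (r + i) - sg r)%:~R / 2 + (sg (s + j) - sg s)%:~R / 2.
Proof. by rewrite /Defs.sg2 -mulrBl -mulrDl -rmorphB -rmorphD /=; congr (_%:~R / _); ring. Qed.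

Variable q : C.
Hypotheses (q0 : q != 0) (q1 : `|q| < 1).

Lemma abs_summable_gauss_pow (a : int) (y : C) : 0 < a -> y != 0 ->
  abs_summable (fun n : int => q ^ (a * binz2 n) * y ^ n).
Proof.
move=> a0 y0; have := abs_summable_gauss (q := q ^ a) _ _ y0.
move/(_ (expfz_neq0 _ q0)); have -> : `|q ^ a| < 1.
  by rewrite normfXz; case: a a0 => // a a0; rewrite -exprnP exprn_ilt1 // -lt0n.
by move/(_ isT); apply: abs_summable_le => n; rewrite exprz_exp.
Qed.

(** Where [sg2] does not vanish, r s >= 0, so q^(b r s) has modulus at most 1 and a product of two
    Gaussian terms dominates. *)
Lemma abs_summable_hecke (a b c : int) (x y : C) :
  0 < a -> 0 <= b -> 0 < c -> x != 0 -> y != 0 ->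
  abs_summable (fun p : int * int => sg2 p.1 p.2 * hecke_mono a b c x y q p.1 p.2).
Proof.
move=> a0 b0 c0 x0 y0.
have := abs_summableM (abs_summable_gauss_pow a0 x0) (abs_summable_gauss_pow c0 y0).
apply: abs_summable_le => -[r s] /=.
have [rs|rs] := boolP (((0 <= r) && (0 <= s)) || ((r < 0) && (s < 0))); last first.
  by rewrite sg2E; move: rs; case: andP => //= _; case: andP => //= _; rewrite mul0r normr0.
have -> : `|sg2 r s * hecke_mono a b c x y q r s| = `|hecke_mono a b c x y q r s|.
  rewrite normrM sg2E; move: rs; case: andP => /= _; first by rewrite normr1 mul1r.
  by case: andP => //= _; rewrite normrN normr1 mul1r.
rewrite /hecke_mono !normrM !normfXz normrN normr1 exp1rz mul1r.
rewrite !(expfzDr _ _ (_ : `|q| != 0)) ?normr_eq0 //.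
set A := _ ^ (a * _); set B := _ ^ (b * r * s); set D := _ ^ (c * _).
have -> : `|x| ^ r * `|y| ^ s * (A * B * D) = (A * `|x| ^ r * (D * `|y| ^ s)) * B by ring.
rewrite ler_piMr ?mulr_ge0 ?exprz_ge0 //.
rewrite -[1]/(`|q| ^ 0); apply: ler_iXz2l; [by rewrite normr_gt0 | exact: ltW |].
by rewrite -mulrA mulr_ge0 //; nia.
Qed.

Lemma hecke_fP (a b c : int) (x y : C) :
  0 < a -> 0 <= b -> 0 < c -> x != 0 -> y != 0 ->
  has_sum (fun p : int * int => sg2 p.1 p.2 * hecke_mono a b c x y q p.1 p.2)
    (hecke_f a b c x y q).
Proof.
move=> a0 b0 c0 x0 y0.
have [l hl] := abs_summable_has_sum (abs_summable_hecke a0 b0 c0 x0 y0).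
suff -> : hecke_f a b c x y q = l by [].
apply: has_sum_sum; apply: eq_has_sum hl => p.
by rewrite /hecke_mono !mulrA.
Qed.

(** Used to see the boundary terms of a shift as differences of two summable families. *)
Lemma abs_summable_hecke_shift (a b c : int) (x y : C) (i j : int) :
  0 < a -> 0 <= b -> 0 < c -> x != 0 -> y != 0 ->
  abs_summable (fun p : int * int =>
    sg2 (p.1 + i) (p.2 + j) * hecke_mono a b c x y q p.1 p.2).
Proof.
move=> a0 b0 c0 x0 y0.
pose f (p : int * int) := (p.1 + i, p.2 + j).
have fi : injective f by move=> [r s] [r' s'] [/addIr -> /addIr ->].
have := abs_summable_inj fi (abs_summableZ (hecke_mono a b c x y q (- i) (- j))
  (abs_summable_hecke (x := x * q ^ (a * (- i) + b * (- j)))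
     (y := y * q ^ (b * (- i) + c * (- j))) a0 b0 c0 _ _)).
rewrite !mulf_neq0 ?expfz_neq0 // => /(_ isT isT).
apply: abs_summable_le => -[r s] /=.
by rewrite [X in _ <= `|X|]mulrCA -hecke_mono_shift // !addrK.
Qed.

(* The substitution n -> 1 - 2l - n preserves the exponent of q and flips the sign. *)
Lemma has_sum_theta0 (l : int) :
  has_sum (fun n : int => (-1) ^ n * q ^ binz2 n * (q ^ l) ^ n) 0.
Proof.
have [L hL] : exists L, has_sum (fun n : int => (-1) ^ n * q ^ binz2 n * (q ^ l) ^ n) L.
  apply: abs_summable_has_sum; have := abs_summable_gauss q0 q1 (expfz_neq0 l q0).
  apply: abs_summable_le => n; rewrite -mulrA normrM normfXz normrN normr1 exp1rz.
  by rewrite mul1r.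
pose f (n : int) := 1 - 2 * l - n.
have ff : cancel f f by move=> n; rewrite /f; ring.
have := has_sumZ (-1) (has_sum_bij ff ff hL).
have -> : (fun n => -1 * ((fun n : int => (-1) ^ n * q ^ binz2 n * (q ^ l) ^ n) \o f) n)
  = (fun n : int => (-1) ^ n * q ^ binz2 n * (q ^ l) ^ n).
  apply/funext => n; rewrite [LHS]/=.
  have e1 : (-1 : C) ^ f n = - (-1) ^ n.
    rewrite -[RHS]mulN1r -[X in X * _]expr1z -expfzDr ?oppr_eq0 ?oner_eq0 //.
    by rewrite -(exprN1_even _ (f n) (l + n)); congr (_ ^ _); rewrite /f; ring.
  have e2 : q ^ binz2 (f n) * (q ^ l) ^ f n = q ^ binz2 n * (q ^ l) ^ n.
    rewrite !exprz_exp -!expfzDr //; congr (_ ^ _).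
    by apply: (@mulfI _ (2 : int)) => //; rewrite !mulrDr !binz2E /f; ring.
  by rewrite e1 -!mulrA e2 mulN1r mulNr opprK.
move=> /(has_sum_unique hL) /eqP; rewrite mulN1r -addr_eq0 -mulr2n mulrn_eq0 /= => /eqP L0.
by rewrite L0 in hL.
Qed.

(** For fixed r the weight is constant and the sum over s is a theta series at q^(l + b r), zero by
    [has_sum_theta0]; hence c = 1 and a power of q as second argument. *)
Lemma has_sum_hecke_col (a b : int) (x : C) (l i : int) :
  0 < a -> 0 <= b -> x != 0 ->
  has_sum (fun p : int * int =>
    (sg (p.1 + i) - sg p.1)%:~R / 2 * hecke_mono a b 1 x (q ^ l) q p.1 p.2) 0.
Proof.
move=> a0 b0 x0; have y0 := expfz_neq0 l q0.
have hs : abs_summable (fun p : int * int =>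
    (sg (p.1 + i) - sg p.1)%:~R / 2 * hecke_mono a b 1 x (q ^ l) q p.1 p.2).
  have := abs_summableB (abs_summable_hecke_shift i 0 a0 b0 ltr01 x0 y0)
    (abs_summable_hecke a0 b0 ltr01 x0 y0).
  apply: abs_summable_le => -[r s] /=.
  by rewrite -mulrBl sg2_shift !addr0 subrr mul0r addr0.
have [L hL] := abs_summable_has_sum hs.
have := has_sum_rows hL (r := fun _ => 0) _; move/(_ _)/has_sum_unique => h.
suff <- : L = 0 by [].
apply: (h _ _ (@has_sum0 _ _)) => r /=.
have := has_sumZ ((sg (r + i) - sg r)%:~R / 2 * ((-1) ^ r * x ^ r * q ^ (a * binz2 r)))
   (has_sum_theta0 (l + b * r)).
rewrite mulr0; apply: eq_has_sum => s; rewrite -[LHS]mulrA; congr (_ * _).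
rewrite /hecke_mono !exprz_exp mul1r !(expfzDr _ _ q0) mulrDl !(expfzDr _ _ q0).
by rewrite expfzDr ?oppr_eq0 ?oner_eq0 //; ring.
Qed.

Lemma has_sum_hecke_row (b c : int) (y : C) (l j : int) :
  0 <= b -> 0 < c -> y != 0 ->
  has_sum (fun p : int * int =>
    (sg (p.2 + j) - sg p.2)%:~R / 2 * hecke_mono 1 b c (q ^ l) y q p.1 p.2) 0.
Proof.
move=> b0 c0 y0; pose sw (p : int * int) := (p.2, p.1).
have sK : cancel sw sw by case.
have := has_sum_bij sK sK (has_sum_hecke_col l j c0 b0 y0).
by apply: eq_has_sum => -[r s] /=; rewrite hecke_monoC.
Qed.

(* Shifting the summation indices changes the sign factor on finitely many lines only; along each
   of them the sum is a theta series at an integral power of q, hence zero. *)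
Lemma hecke_f_shift (b k l i j : int) : 0 <= b ->
  hecke_f 1 b 1 (q ^ k) (q ^ l) q =
  hecke_mono 1 b 1 (q ^ k) (q ^ l) q i j *
    hecke_f 1 b 1 (q ^ (k + i + b * j)) (q ^ (l + b * i + j)) q.
Proof.
move=> b0; have z n : q ^ n != 0 by apply: expfz_neq0.
pose f (p : int * int) := (p.1 + i, p.2 + j).
pose g (p : int * int) := (p.1 - i, p.2 - j).
have fg : cancel f g by case=> r s; rewrite /f /g /= !addrK.
have gf : cancel g f by case=> r s; rewrite /f /g /= !addrNK.
have h1 := has_sum_bij fg gf (hecke_fP ltr01 b0 ltr01 (z k) (z l)).
have := has_sumD (hecke_fP ltr01 b0 ltr01 (z (k + i + b * j)) (z (l + b * i + j)))
  (has_sumD (has_sum_hecke_col (l + b * i + j) i ltr01 b0 (z (k + i + b * j)))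
    (has_sum_hecke_row (k + i + b * j) j b0 ltr01 (z (l + b * i + j)))).
rewrite !addr0 => /(has_sumZ (hecke_mono 1 b 1 (q ^ k) (q ^ l) q i j)).
apply: has_sum_unique; apply: eq_has_sum h1 => -[r s] /=.
rewrite hecke_mono_shift // -!expfzDr // !mul1r [LHS]mulrCA; congr (_ * _).
by rewrite -mulrDl -mulrDl -sg2_shift [X in _ = X * _]addrC subrK !addrA.
Qed.

End HeckeSums.

(** * Jacobi triple product *)

Definition qpoch (K : pzRingType) (a q : K) (n : nat) : K := \prod_(0 <= k < n) (1 - a * q ^+ k).

Lemma qpoch0 (K : pzRingType) (a q : K) : qpoch a q 0 = 1.
Proof. by rewrite /qpoch big_geq. Qed.

Lemma qpochS (K : pzRingType) (a q : K) n : qpoch a q n.+1 = qpoch a q n * (1 - a * q ^+ n).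
Proof. by rewrite /qpoch big_nat_recr. Qed.

Lemma qpochD (K : comPzRingType) (a q : K) k n :
  qpoch a q (k + n) = qpoch a q k * qpoch (a * q ^+ k) q n.
Proof.
elim: n => [|n IH]; first by rewrite addn0 qpoch0 mulr1.
by rewrite addnS !qpochS IH exprD !mulrA.
Qed.

Lemma qpoch_neq0 (K : fieldType) (a q : K) n :
  (forall k, 1 - a * q ^+ k != 0) -> qpoch a q n != 0.
Proof. by move=> h; elim: n => [|n IH]; rewrite ?qpoch0 ?oner_eq0 // qpochS mulf_neq0. Qed.

(** Weierstrass product inequalities, the upper one kept free of division. The induction rests on (1
    - s)(1 - y) >= 1 - (s + y) and (1 + y)(1 - (s + y)) <= 1 - s. *)
Lemma qpoch_estimates (K : numFieldType) (a q : K) n :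
  (forall n, `|a| * \sum_(k < n) `|q| ^+ k <= 2^-1) ->
  1 - `|a| * \sum_(k < n) `|q| ^+ k <= `|qpoch a q n| /\
  `|qpoch a q n| * (1 - `|a| * \sum_(k < n) `|q| ^+ k) <= 1.
Proof.
have e1 (u v : K) : (1 - u) * (1 - v) - (1 - (u + v)) = u * v by ring.
have e2 (u v : K) : 1 - u - (1 + v) * (1 - (u + v)) = u * v + v * v by ring.
move=> hs; have half : 2^-1 <= 1 :> K by rewrite invf_le1 ?ler1n.
elim: n => [|n [IH1 IH2]]; first by rewrite qpoch0 big_ord0 mulr0 subr0 normr1 mulr1.
rewrite qpochS big_ord_recr /= mulrDr normrM.
set s := `|a| * _ in IH1 IH2 *; set y := `|a| * `|q| ^+ n.
have y0 : 0 <= y by rewrite mulr_ge0 // exprn_ge0.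
have s0 : 0 <= s by rewrite mulr_ge0 // sumr_ge0 // => i _; rewrite exprn_ge0.
have yE : `|a * q ^+ n| = y by rewrite normrM normrX.
have sy : s + y <= 2^-1.
  by have := hs n.+1; rewrite big_ord_recr /= mulrDr.
have s1 : 0 <= 1 - s by rewrite subr_ge0 (le_trans (hs n)).
have y1 : 0 <= 1 - y by rewrite subr_ge0; apply: le_trans half; apply: le_trans sy; rewrite lerDr.
have sy1 : 0 <= 1 - (s + y) by rewrite subr_ge0 (le_trans sy).
split.
  apply: (@le_trans _ _ ((1 - s) * (1 - y))).
    by rewrite -subr_ge0 e1 mulr_ge0.
  apply: ler_pM => //; rewrite -yE -{1}(normr1 K); exact: lerB_dist.
apply: le_trans _ IH2; rewrite -mulrA ler_wpM2l //.
apply: (@le_trans _ _ ((1 + y) * (1 - (s + y)))).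
  rewrite ler_wpM2r // -yE -[X in _ <= X + _](normr1 K); exact: ler_normB.
by rewrite -subr_ge0 e2; exact: addr_ge0 (mulr_ge0 s0 y0) (mulr_ge0 y0 y0).
Qed.

Lemma bounded_shift (K : numDomainType) (u : nat -> K) (k : nat) (M : K) :
  (forall n, 0 <= u n) -> (forall n, u (k + n)%N <= M) -> exists B, forall n, u n <= B.
Proof.
move=> u0 hM; exists (M + \sum_(i < k) u i) => n.
have M0 : 0 <= M by apply: le_trans (u0 _) (hM 0%N).
have [kn|nk] := leqP k n.
  by rewrite -(subnKC kn); apply: le_trans (hM _) _; rewrite lerDl sumr_ge0.
by rewrite (bigD1 (Ordinal nk)) //= addrCA lerDl addr_ge0 // sumr_ge0.
Qed.

Section QPochhammer.
Variables (R : realType) (q : R[i]).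
Hypotheses (q0 : q != 0) (q1 : `|q| < 1).
Local Notation C := R[i].

Lemma qpoch_tail (a : C) : exists k, forall n,
  2^-1 <= `|qpoch (a * q ^+ k) q n| /\ `|qpoch (a * q ^+ k) q n| <= 2.
Proof.
have d0 : 0 < 1 - `|q| by rewrite subr_gt0.
(* This makes |a q^k| at most (1 - |q|) / 2, so the sum in [qpoch_estimates] is at most 1/2. The + 1
   covers a = 0. *)
have [k hk] := exprC_small (normr_ge0 q) q1 (e := (1 - `|q|) / 2 / (`|a| + 1))
  ltac:(by rewrite !divr_gt0 // ltr_wpDl).
exists k => n.
have hs n' : `|a * q ^+ k| * \sum_(i < n') `|q| ^+ i <= 2^-1.
  have hg : \sum_(i < n') `|q| ^+ i <= (1 - `|q|)^-1.
    rewrite -(ler_pM2l d0) divff ?gt_eqF // -opprB mulNr -subrX1 opprB.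
    by rewrite lerBlDr lerDl exprn_ge0.
  have ha : `|a * q ^+ k| <= (1 - `|q|) / 2.
    rewrite normrM normrX; apply: (@le_trans _ _ ((`|a| + 1) * `|q| ^+ k)).
      by rewrite ler_wpM2r ?exprn_ge0 // lerDl.
    by rewrite -ler_pdivlMl ?ltr_wpDl // mulrC ltW.
  apply: (@le_trans _ _ ((1 - `|q|) / 2 * (1 - `|q|)^-1)).
    by apply: ler_pM => //; rewrite sumr_ge0 // => i _; rewrite exprn_ge0.
  by rewrite mulrAC divff ?mul1r // gt_eqF.
have [h1 h2] := qpoch_estimates n hs.
have h3 : 2^-1 <= 1 - `|a * q ^+ k| * \sum_(i < n) `|q| ^+ i.
  by rewrite lerBrDr -lerBrDl (le_trans (hs n)) // {2}(splitr 1) mul1r addrK.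
split; first exact: le_trans h1.
rewrite -[leLHS]mulr1 -[X in _ * X](@mulVf _ 2) ?pnatr_eq0 // mulrA -[leRHS]mul1r ler_wpM2r //.
by apply: le_trans h2; rewrite ler_wpM2l.
Qed.

Lemma qpoch_bounded (a : C) : exists M, forall n, `|qpoch a q n| <= M.
Proof.
have [k hk] := qpoch_tail a.
apply: (bounded_shift (k := k) (M := `|qpoch a q k| * 2)) => // n.
by rewrite qpochD normrM ler_wpM2l // (hk n).2.
Qed.

(** Serves twice: for the nonvanishing of the infinite product and for the domination in the triple
    product. *)
Lemma qpochV_bounded (a : C) : (forall k, 1 - a * q ^+ k != 0) ->
  exists M, forall n, `|(qpoch a q n)^-1| <= M.
Proof.
move=> a1; have [k hk] := qpoch_tail a.
apply: (bounded_shift (k := k) (M := `|(qpoch a q k)^-1| * 2)) => // n.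
have h := (hk n).1; have p : 0 < `|qpoch (a * q ^+ k) q n|.
  by apply: lt_le_trans h; rewrite invr_gt0.
by rewrite qpochD invfM normrM ler_wpM2l // normfV -[leRHS]invrK lef_pV2 ?posrE ?invr_gt0.
Qed.

Lemma has_sum_series (d : nat -> C) l : has_sum d l ->
  ((fun n => \sum_(0 <= k < n) d k : C^o) @ \oo --> (l : C^o))%classic.
Proof.
move=> h; apply/cvgrPdist_lt => e e0; have [J HJ] := h e e0.
exists (\max_(i <- J) i).+1 => // n /= Jn; rewrite distrC.
have -> : \sum_(0 <= k < n) d k = \sum_(k <- [fset k in iota 0 n]) d k.
  rewrite big_imfset //= /index_iota subn0.
  by apply: perm_big; apply: uniq_perm; rewrite ?iota_uniq ?undup_uniq // => i; rewrite mem_undup.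
apply: HJ; apply/fsubsetP => i iJ; rewrite !inE /= mem_iota add0n.
by apply: leq_trans Jn; rewrite ltnS; apply: leq_bigmax_seq.
Qed.

(** Telescoping: consecutive partial products differ by - a q^n times a bounded quantity, which is
    summable. *)
Lemma cvg_qpoch (a : C) : ((qpoch a q : nat -> C^o) @ \oo --> (qpoch_inf a q : C^o))%classic.
Proof.
have [M hM] := qpoch_bounded a.
have hs : abs_summable (fun k : nat => - a * q ^+ k * qpoch a q k).
  have Pi : injective Posz by move=> i j [].
  have := abs_summableZ (a * M) (abs_summable_inj Pi
    (abs_summable_geometric (normr_ge0 q) q1)).
  apply: abs_summable_le => k /=; rewrite !normrM normrN !normrX normr_id -!mulrA ler_wpM2l //.
  rewrite [leRHS]mulrC ler_wpM2l ?exprn_ge0 //.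
  exact: le_trans (hM k) (real_ler_norm (ger0_real (le_trans (normr_ge0 _) (hM k)))).
have [l hl] := abs_summable_has_sum hs.
have cv : ((qpoch a q : nat -> C^o) @ \oo --> (1 + l : C^o))%classic.
  have -> : qpoch a q = (fun n => 1 + \sum_(0 <= k < n) (- a * q ^+ k * qpoch a q k)).
    apply/funext; elim=> [|n IH]; first by rewrite qpoch0 big_geq // addr0.
    by rewrite big_nat_recr //= addrA -IH qpochS; ring.
  by apply: cvgD; [exact: cvg_cst | exact: has_sum_series].
suff -> : qpoch_inf a q = 1 + l by [].
by apply: cvg_lim cv; apply: norm_hausdorff.
Qed.

(** Bounded inverses keep the partial products at distance at least 1 / M from 0. *)
Lemma qpoch_inf_neq0 (a : C) : (forall k, 1 - a * q ^+ k != 0) -> qpoch_inf a q != 0.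
Proof.
move=> a1; have [M hM] := qpochV_bounded a1.
have M0 : 0 < M.
  by apply: lt_le_trans (hM 0%N); rewrite normr_gt0 invr_eq0 qpoch_neq0.
apply/eqP => z; have := cvg_qpoch (a := a); rewrite z => /cvgrPdist_lt/(_ M^-1).
rewrite invr_gt0 M0 => /(_ isT)[N _ /(_ N (leqnn _))] /=.
rewrite sub0r normrN -[ltLHS]invrK -normfV ltf_pV2 ?posrE ?normr_gt0 ?invr_eq0 ?qpoch_neq0 //.
by move=> /lt_le_trans/(_ (hM N)); rewrite ltxx.
Qed.

Lemma one_sub_qX_neq0 (k : nat) : 1 - q * q ^+ k != 0.
Proof.
rewrite -exprS subr_eq0; apply/eqP => e.
by have := exprn_ilt1 k.+1 (normr_ge0 q) q1; rewrite -normrX -e normr1 ltxx.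
Qed.

Lemma Theta_neq0 (x : C) : x != 0 -> (forall n : int, x != q ^ n) -> Theta x q != 0.
Proof.
move=> x0 xq; rewrite /Theta !mulf_neq0 ?qpoch_inf_neq0 //; last exact: one_sub_qX_neq0.
  move=> k; rewrite subr_eq0; apply: contra (xq (- k%:Z)) => /eqP e.
  by rewrite -invr_expz -exprnP -[X in _ == X]mul1r e mulfK // expf_neq0.
move=> k; rewrite subr_eq0; apply: contra (xq (k.+1)) => /eqP e.
have h : q * q ^+ k = q / x * q ^+ k * x by rewrite mulrAC divfK.
by rewrite -exprnP exprS h -e mul1r.
Qed.

(* 1 / (q; q)_k, extended by 0 to k < 0: with this convention [qpoch_invB1] holds for every
   integer k, and the triple product needs no boundary cases. *)
Definition qpoch_inv (k : int) : C := if k is Posz n then (qpoch q q n)^-1 else 0.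

Lemma qpoch_invB1 (k : int) : qpoch_inv (k - 1) = (1 - q ^ k) * qpoch_inv k.
Proof.
case: k => [[|n]|n].
- by rewrite expr0z subrr mul0r.
- rewrite (_ : n.+1%:Z - 1 = n) /=; last by rewrite -addn1 PoszD addrK.
  rewrite qpochS invfM mulrCA -exprnP exprS mulfV ?mulr1 //; exact: one_sub_qX_neq0.
- by rewrite /= mulr0; case: n.
Qed.

Section TripleProduct.
Variable x : C.
Hypothesis x0 : x != 0.

Let theta (j : int) : C := (-1) ^ j * q ^ binz2 j * x ^ j.

(** The Gaussian binomial coefficient of M + N over N + j, zero unless - N <= j <= M. *)
Let coef (M N : nat) (j : int) : C :=
  qpoch q q (M + N) * (qpoch_inv (M%:Z - j) * qpoch_inv (N%:Z + j)).

Lemma theta_pred (j : int) : x * theta (j - 1) = - theta j * q ^ (1 - j).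
Proof.
rewrite /theta.
have n1 : (-1 : C) != 0 by rewrite oppr_eq0 oner_eq0.
have -> : j = (j - 1) + 1 by ring.
move: (j - 1) => i; rewrite (_ : 1 - (i + 1) = - i); last by ring.
rewrite addrK binz2D (_ : binz2 1 = 0) // addr0 mulr1.
rewrite !(expfzDr _ _ n1) !(expfzDr _ _ q0) !(expfzDr _ _ x0) !expr1z.
rewrite -invr_expz; field; exact: expfz_neq0.
Qed.

(** The q-Pascal rule for the new factor 1 - x q^M: it reduces to (1 - A) + A (1 - B) = 1 - A B with
    A = q^(M + 1 - j) and B = q^(N + j). *)
Lemma coef_stepM (M N : nat) (j : int) :
  theta j * coef M N j - x * q ^+ M * (theta (j - 1) * coef M N (j - 1)) =
  theta j * coef M.+1 N j.
Proof.
have -> : x * q ^+ M * (theta (j - 1) * coef M N (j - 1))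
   = (x * theta (j - 1)) * q ^+ M * coef M N (j - 1) by ring.
rewrite theta_pred /coef addSn qpochS.
have -> : M%:Z - j = M.+1%:Z - j - 1 by rewrite -addn1 PoszD; ring.
have -> : M%:Z - (j - 1) = M.+1%:Z - j by rewrite -addn1 PoszD; ring.
have -> : N%:Z + (j - 1) = N%:Z + j - 1 by ring.
rewrite !qpoch_invB1.
have e1 : q ^ (1 - j) * q ^+ M = q ^ (M.+1%:Z - j).
  by rewrite exprnP -expfzDr //; congr (_ ^ _); rewrite -addn1 PoszD; ring.
have e2 : q * q ^+ (M + N) = q ^ (M.+1%:Z - j) * q ^ (N%:Z + j).
  by rewrite -exprS exprnP -expfzDr //; congr (_ ^ _); rewrite -addn1 -[M.+1]addn1 !PoszD; ring.
by rewrite e2 -[- _ * _ * _]mulrA e1; ring.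
Qed.

Lemma coef_stepN (M N : nat) (j : int) :
  theta j * coef M N j - q / x * q ^+ N * (theta (j + 1) * coef M N (j + 1)) =
  theta j * coef M N.+1 j.
Proof.
have -> : q / x * q ^+ N * (theta (j + 1) * coef M N (j + 1))
   = (x^-1 * theta (j + 1)) * (q * q ^+ N) * coef M N (j + 1) by ring.
have -> : x^-1 * theta (j + 1) = - theta j * q ^ j.
  apply: (mulfI x0); rewrite mulVKf //.
  have := theta_pred (j + 1); rewrite addrK (_ : 1 - (j + 1) = - j); last by ring.
  by move=> h; rewrite mulrA mulrN h !mulNr opprK -mulrA -expfzDr // addNr mulr1.
rewrite /coef addnS qpochS.
have -> : N%:Z + j = N.+1%:Z + j - 1 by rewrite -addn1 PoszD; ring.
have -> : N%:Z + (j + 1) = N.+1%:Z + j by rewrite -addn1 PoszD; ring.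
have -> : M%:Z - (j + 1) = M%:Z - j - 1 by ring.
rewrite !qpoch_invB1.
have e1 : q ^ j * (q * q ^+ N) = q ^ (N.+1%:Z + j).
  by rewrite -exprS exprnP -expfzDr // addrC.
have e2 : q * q ^+ (M + N) = q ^ (M%:Z - j) * q ^ (N.+1%:Z + j).
  by rewrite -exprS exprnP -expfzDr //; congr (_ ^ _); rewrite -addn1 -[N.+1]addn1 !PoszD; ring.
by rewrite e2 -[- _ * _ * _]mulrA e1; ring.
Qed.

(** Letting M and N vary separately makes each induction step a multiplication by one linear factor,
    that is, one q-Pascal rule. *)
Lemma finite_triple_product (M N : nat) :
  has_sum (fun j : int => theta j * coef M N j) (qpoch x q M * qpoch (q / x) q N).
Proof.
pose up (j : int) := j + 1; pose dn (j : int) := j - 1.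
have upK : cancel up dn by move=> j; rewrite /up /dn addrK.
have dnK : cancel dn up by move=> j; rewrite /up /dn subrK.
elim: M => [|M IH].
  elim: N => [|N IH].
    have := @has_sum_single _ _ (fun j : int => theta j * coef 0 0 j) 0.
    rewrite /theta /coef /qpoch_inv /= !qpoch0 !expr0z invr1 !mulr1; apply=> j.
    by case: j => [[|n]|n] //; rewrite ?mulr0 ?mul0r ?mulr0.
  rewrite qpochS (_ : _ * _ = qpoch x q 0 * qpoch (q / x) q N
    - q / x * q ^+ N * (qpoch x q 0 * qpoch (q / x) q N)); last by ring.
  apply: eq_has_sum (has_sumB IH (has_sumZ (q / x * q ^+ N) (has_sum_bij upK dnK IH))) => j.
  exact: coef_stepN.
rewrite qpochS (_ : _ * _ = qpoch x q M * qpoch (q / x) q N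
  - x * q ^+ M * (qpoch x q M * qpoch (q / x) q N)); last by ring.
apply: eq_has_sum (has_sumB IH (has_sumZ (x * q ^+ M) (has_sum_bij dnK upK IH))) => j.
exact: coef_stepM.
Qed.

End TripleProduct.
End QPochhammer.

(** * Dominated passage to the limit in the finite triple product *)

Section Tannery.
Variable R : realType.
Local Notation C := R[i].

Lemma cvg_uniform_fset (I : choiceType) (c : nat -> I -> C) (s : seq I) (d : C) : 0 < d ->
  (forall i, ((fun n => c n i : C^o) @ \oo --> (1 : C^o))%classic) ->
  exists N, forall n, (N <= n)%N -> forall i, i \in s -> `|c n i - 1| < d.
Proof.
move=> d0 h; elim: s => [|i s [N1 H1]]; first by exists 0%N.
have /cvgrPdist_lt/(_ d d0)[N2 _ H2] := h i.
exists (maxn N1 N2) => n; rewrite geq_max => /andP[n1 n2] k.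
by rewrite inE => /orP[/eqP->|/(H1 n n1)//]; rewrite distrC; exact: (H2 n n2).
Qed.

(** On a finite [J] carrying almost all of the sum of |u| the weights are uniformly close to 1; off
    [J] it suffices that they are bounded. *)
Lemma tannery (I : choiceType) (u : I -> C) (c : nat -> I -> C) (L : C) (T : nat -> C) (B : C) :
  abs_summable u -> has_sum u L -> (forall n i, `|c n i| <= B) ->
  (forall i, ((fun n => c n i : C^o) @ \oo --> (1 : C^o))%classic) ->
  (forall n, has_sum (fun i => u i * c n i) (T n)) ->
  ((T : nat -> C^o) @ \oo --> (L : C^o))%classic.
Proof.
move=> us uL cB c1 hT.
have [A hA] : exists A, has_sum (fun i => `|u i|) A.
  by apply: abs_summable_has_sum; apply: abs_summable_le us => i; rewrite normr_id.
(* [B] is known to be nonnegative only if [I] is inhabited. *)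
have [i0|] := pselect (exists i : I, True); last first.
  move=> noI; have TL n : T n = L.
    by apply: has_sum_unique (hT n) (eq_has_sum _ uL) => i; case: noI; exists i.
  by rewrite (_ : T = fun _ => L); [exact: cvg_cst | exact/funext].
have B0 : 0 <= B by case: i0 => i _; apply: le_trans (cB 0%N i).
pose D := B + 1.
have D0 : 0 < D by rewrite ltr_wpDl.
have cD n i : `|c n i - 1| <= D.
  by apply: le_trans (ler_normB _ _) _; rewrite normr1 lerD2r.
apply/cvgrPdist_lt => e e0.
have e4 : 0 < e / 4 by rewrite divr_gt0.
(* The tail beyond [J] is a difference of two sums, each this close to [A]; hence the extra factor
   1/2. *)
have [J HJ] := hA (e / 4 / D / 2) ltac:(by rewrite !divr_gt0).
pose s := \sum_(i <- J) `|u i|.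
have s0 : 0 <= s by rewrite sumr_ge0.
have [N HN] := cvg_uniform_fset J (d := e / 4 / (s + 1)) ltac:(by rewrite divr_gt0 // ltr_wpDl) c1.
exists N => // n /= Nn; rewrite distrC.
have [J2 HJ2] := has_sumB (hT n) uL e4.
(* [J2] depends on n, but [J] and [N] do not, so the final bound is uniform in n. *)
have := HJ2 (J `|` J2) (fsubsetUr _ _); set K := J `|` J2 => hK.
have JK : J `<=` K by apply: fsubsetUl.
have tail : \sum_(i <- K) `|u i| - s <= e / 4 / D.
  have h1 := ltW (HJ K JK); have h2 := ltW (HJ J (fsubset_refl _)).
  have -> : \sum_(i <- K) `|u i| - s = (\sum_(i <- K) `|u i| - A) - (s - A) by ring.
  rewrite [leRHS]splitr; apply: le_trans (lerD h1 h2).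
  apply: le_trans (ler_normB _ _); rewrite real_ler_norm //; apply: ger0_real.
  have -> : (\sum_(i <- K) `|u i| - A) - (s - A) = \sum_(i <- K) `|u i| - s by ring.
  by rewrite subr_ge0 ler_sum_fset.
have main : `|\sum_(i <- K) (u i * c n i - u i)| <= e / 4 + e / 4.
  apply: le_trans (ler_norm_sum _ _ _) _.
  pose g i := if i \in J then `|u i| else 0.
  apply: (@le_trans _ _ (\sum_(i <- K) (D * (`|u i| - g i) + e / 4 / (s + 1) * g i))).
    apply: ler_sum => i _; rewrite -[X in _ - X]mulr1 -mulrBr normrM /g.
    case: ifP => iJ.
      rewrite subrr mulr0 add0r mulrC ler_wpM2r // ltW //; exact: HN.
    by rewrite subr0 mulr0 addr0 mulrC ler_wpM2r.
  rewrite big_split /= -!mulr_sumr sumrB sum_fset_if // -/s; apply: lerD.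
    by rewrite mulrC -ler_pdivlMr.
  by rewrite mulrAC ler_pdivrMr ?ltr_wpDl // ler_wpM2l ?ltW // ltrDl.
have -> : T n - L = \sum_(i <- K) (u i * c n i - u i)
  - (\sum_(i <- K) (u i * c n i - u i) - (T n - L)) by ring.
apply: le_lt_trans (ler_normB _ _) _.
apply: lt_le_trans (ler_ltD main hK) _.
have -> : e / 4 + e / 4 + e / 4 = e - e / 4 by field.
by rewrite lerBlDr lerDl ltW.
Qed.

End Tannery.

Section Jacobi.
Variables (R : realType) (q : R[i]).
Hypotheses (q0 : q != 0) (q1 : `|q| < 1).
Local Notation C := R[i].

Let Q := qpoch_inf q q.

Lemma cvg_qpoch_inv (j : int) :
  ((fun n : nat => qpoch_inv q (n%:Z + j) : C^o) @ \oo --> (Q^-1 : C^o))%classic.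
Proof.
have Q0 : Q != 0 by apply: qpoch_inf_neq0 => // k; apply: one_sub_qX_neq0.
have cv : ((fun n => (qpoch q q n)^-1 : C^o) @ \oo --> (Q^-1 : C^o))%classic.
  by apply: cvgV => //; apply: cvg_qpoch.
have {}cv := (cvgrPdist_lt _ _).1 cv.
apply/cvgrPdist_lt => e /cv[N _ HN]; exists (N + `|j|)%N => // n /= hn.
have -> : n%:Z + j = absz (n%:Z + j) by lia.
by apply: HN => /=; lia.
Qed.

Theorem jacobi_triple_product (x : C) : x != 0 ->
  has_sum (fun n : int => (-1) ^ n * q ^ binz2 n * x ^ n) (Theta x q).
Proof.
move=> x0; have q1n := one_sub_qX_neq0 q1.
have Q0 : Q != 0 by apply: qpoch_inf_neq0.
(* The Gaussian binomial tends to 1 / Q; the extra factor [qpoch q q n] makes the weights tend to 1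
   and supplies the third factor of [Theta]. *)
pose c (n : nat) (j : int) : C :=
  qpoch q q n * (qpoch q q (n + n) * (qpoch_inv q (n%:Z - j) * qpoch_inv q (n%:Z + j))).
have us : abs_summable (fun n : int => (-1) ^ n * q ^ binz2 n * x ^ n).
  apply: abs_summable_le (abs_summable_gauss q0 q1 x0) => n.
  by rewrite -mulrA normrM normfXz normrN normr1 exp1rz mul1r.
have [L hL] := abs_summable_has_sum us.
have [M hM] := qpoch_bounded q1 q; have [V hV] := qpochV_bounded q1 q1n.
have V0 : 0 <= V by apply: le_trans (hV 0%N).
have hV' k : `|qpoch_inv q k| <= V by case: k => n //=; rewrite normr0.
have cB n j : `|c n j| <= M * (M * (V * V)).
  by rewrite !normrM !ler_pM ?mulr_ge0.
have c1 j : ((fun n => c n j : C^o) @ \oo --> (1 : C^o))%classic.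
  have -> : 1 = Q * (Q * (Q^-1 * Q^-1)) by field.
  have cv := cvg_qpoch q1 (a := q).
  apply: (@cvgM C^o); first exact: cv.
  apply: (@cvgM C^o); last by apply: (@cvgM C^o); apply: cvg_qpoch_inv.
  have {}cv := (cvgrPdist_lt _ _).1 cv; apply/cvgrPdist_lt => e /cv[N _ HN].
  by exists N => // n /= Nn; apply: HN => /=; lia.
pose T n := qpoch q q n * (qpoch x q n * qpoch (q / x) q n).
have hT n : has_sum (fun j : int => (-1) ^ j * q ^ binz2 j * x ^ j * c n j) (T n).
  apply: eq_has_sum (has_sumZ (qpoch q q n) (finite_triple_product q0 q1 x0 n n)) => j.
  by rewrite /c mulrCA.
have TL := tannery us hL cB c1 hT.
have TTheta : ((T : nat -> C^o) @ \oo --> (Theta x q : C^o))%classic.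
  rewrite /Theta mulrC.
  by apply: (@cvgM C^o); last apply: (@cvgM C^o); apply: cvg_qpoch.
suff -> : Theta x q = L by [].
rewrite -[RHS](cvg_lim (@norm_hausdorff _ C^o) TL); apply/esym.
by apply: cvg_lim TTheta; apply: norm_hausdorff.
Qed.

End Jacobi.

(** * The quadruple sum *)

Section Appell.
Variables (R : realType) (q : R[i]).
Hypotheses (q0 : q != 0) (q1 : `|q| < 1).
Local Notation C := R[i].
Local Notation sg2 := (@sg2 R).

Variable x : C.
Hypotheses (x0 : x != 0) (xq : forall n : int, x != q ^ n).

Lemma one_sub_mulXz_neq0 (r : int) : 1 - x * q ^ r != 0.
Proof.
rewrite subr_eq0; apply: contra (xq (- r)) => /eqP e; apply/eqP.
by rewrite -invr_expz -[RHS]mul1r e mulfK // expfz_neq0.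
Qed.

(** The weight is - 1 on the line [p.2 = 0] and 0 elsewhere. On that line q^l has exponent 0, and r
    -> - r turns the theta series of q / x into that of x. *)
Lemma has_sum_hecke_line (l : int) :
  has_sum (fun p : int * int => (sg (p.2 - 1) - sg p.2)%:~R / 2 *
    hecke_mono 1 1 1 (q / x) (q ^ l) q p.1 p.2) (- Theta x q).
Proof.
have X0 : q / x != 0 by rewrite mulf_neq0 ?invr_eq0.
have Y0 := expfz_neq0 l q0.
pose u (p : int * int) := (sg (p.2 - 1) - sg p.2)%:~R / 2 *
    hecke_mono 1 1 1 (q / x) (q ^ l) q p.1 p.2.
have hs : abs_summable u.
  have := abs_summableB (abs_summable_hecke_shift q0 q1 0 (-1) ltr01 ler01 ltr01 X0 Y0)
    (abs_summable_hecke q0 q1 ltr01 ler01 ltr01 X0 Y0).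
  apply: abs_summable_le => -[r s]; rewrite /u /=.
  by rewrite -mulrBl sg2_shift !addr0 subrr mul0r add0r.
have [L hL] := abs_summable_has_sum hs; rewrite -/u.
suff <- : L = - Theta x q by [].
pose sw (p : int * int) := (p.2, p.1).
have sK : cancel sw sw by case.
have rows (s : int) : has_sum (fun r : int => (u \o sw) (s, r)) (if s == 0 then - Theta x q else 0).
  rewrite /u /=; case: eqP => [->|s0]; last first.
    apply: eq_has_sum (@has_sum0 _ _) => r.
    have -> : sg (s - 1) - sg s = 0.
      by rewrite /sg; case: (leP 0 s) => ?; case: (leP 0 (s - 1)) => ? //; lia.
    by rewrite !mul0r.
  have iK : cancel (fun n : int => - n) (fun n => - n) by move=> n; rewrite opprK.
  have := has_sumZ (-1) (has_sum_bij iK iK (jacobi_triple_product q0 q1 x0)).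
  rewrite mulN1r; apply: eq_has_sum => r /=.
  have -> : (sg (0 - 1) - sg 0)%:~R / 2 = -1 :> C.
    by rewrite (_ : (sg (0 - 1) - sg 0)%:~R = - 2 :> C) // mulNr divff ?pnatr_eq0.
  congr (_ * _); rewrite /hecke_mono binz2N expr0z mulr1 addr0.
  have -> : 1 * binz2 r + 1 * r * 0 + 1 * binz2 0 = binz2 r.
    by rewrite (_ : binz2 0 = 0) //; ring.
  rewrite expfzDr // expfzMl exprz_inv -(exprN1_even _ (- r) r).
  by rewrite (_ : - r + 2 * r = r); ring.
apply: has_sum_unique (has_sum_rows (has_sum_bij sK sK hL) rows) _.
have := @has_sum_single _ _ (fun s : int => if s == 0 then - Theta x q else 0) 0.
by rewrite eqxx; apply => s /negbTE ->.
Qed.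

(* Shifting by (1, -1) multiplies the summand by 1 / (x q^r); of the two lines on which the sign
   factor changes, one sums to zero and the other to [Theta x q]. *)
Lemma hecke_f111 (r : int) :
  hecke_f 1 1 1 (q / x) (q ^ (1 + r)) q = Theta x q / (1 - x * q ^ r).
Proof.
have X0 : q / x != 0 by rewrite mulf_neq0 ?invr_eq0.
have Y0 := expfz_neq0 (1 + r) q0.
set L := hecke_f _ _ _ _ _ _.
have hL : has_sum _ L := hecke_fP q0 q1 ltr01 ler01 ltr01 X0 Y0.
pose f (p : int * int) := (p.1 + 1, p.2 - 1).
pose g (p : int * int) := (p.1 - 1, p.2 + 1).
have fg : cancel f g by case=> a b; congr pair; rewrite /f /g /=; ring.
have gf : cancel g f by case=> a b; congr pair; rewrite /f /g /=; ring.
have h1 := has_sumZ (x * q ^ r) (has_sum_bij fg gf hL).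
have h2 := has_sumD hL (has_sumD (has_sum_hecke_col q0 q1 (1 + r) 1 ltr01 ler01 X0)
  (has_sum_hecke_line (1 + r))).
have e : x * q ^ r * L = L + (0 - Theta x q).
  apply: has_sum_unique h1 (eq_has_sum _ h2) => -[a b] /=.
  rewrite -mulrDl -mulrDl -sg2_shift addrC subrK hecke_mono_shift //.
  have -> : 1 * 1 + 1 * -1 = 0 :> int by [].
  rewrite !expr0z !mulr1 [RHS]mulrCA; congr (_ * _).
  rewrite mulrA -[LHS]mul1r; congr (_ * _).
  rewrite /hecke_mono.
  have -> : 1 * binz2 1 + 1 * 1 * -1 + 1 * binz2 (-1) = 0 :> int by [].
  rewrite !expr0z mul1r mulr1 !expr1z -[(q ^ (1 + r)) ^ _]/((q ^ (1 + r))^-1).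
  rewrite expfzDr // expr1z; field.
  by rewrite q0 expfz_neq0 // x0.
have -> : Theta x q = L * (1 - x * q ^ r).
  by rewrite mulrBr mulr1 [L * _]mulrC e; ring.
by rewrite mulfK // one_sub_mulXz_neq0.
Qed.

Variables (al be : int).
Hypotheses (al0 : 0 <= al) (albe : 1 <= al + be) (al2be : 1 <= al + 2 * be).
Local Notation t := (al + be).
Local Notation m := (al - be).

Let u (P : (int * int) * (int * int)) : C :=
  (sg2 P.1.1 P.1.2 * hecke_mono 1 (2 * t) 1 (q ^ (1 + al)) (q ^ (1 + be)) q P.1.1 P.1.2)
  * (sg2 P.2.1 P.2.2 * hecke_mono 1 1 1 (q / x) (q ^ (1 + P.1.1)) q P.2.1 P.2.2).

(* [al = (t + m) / 2] and [be = (t - m) / 2], so that [al0] and [al2be] are the hypotheses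
   - t <= m and m <= 3t - 2. *)
Lemma quadruple_exponent (r s r' j : int) :
  (0 <= r) && (0 <= s) || (r < 0) && (s < 0) ->
  (0 <= r') && (0 <= j) || (r' < 0) && (j < 0) ->
  `|r| + `|s| + (`|j| + 2 * binz2 (- r')) - (be ^+ 2 + (be + 1) ^+ 2) <=
  2 * (binz2 r + 2 * t * r * s + binz2 s + (1 + al) * r + (1 + be) * s
       + (binz2 r' + r' * j + binz2 j + r' + (1 + r) * j)).
Proof.
have sq (z : int) : 0 <= z ^+ 2 by exact: sqr_ge0.
have t0 : 0 <= t by apply: le_trans albe.
have e0 : 0 <= al + 2 * be - 1 by rewrite subr_ge0.
rewrite !mulrDr !binz2E.
(* Each sign pattern has its own completion into squares and nonnegative products; completing the
   square in s costs be^2 or (be + 1)^2. If r and j have opposite signs, rj goes into (r + j)^2. If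
   r, s < 0, one unit of - s is split off from r s to offset the linear term in r, which is where al
   + 2 be >= 1 enters. *)
case/orP=> /andP[hr hs]; case/orP=> /andP[hr' hj]; rewrite -subr_ge0.
- rewrite !ger0_norm // [leRHS](_ : _ = r ^+ 2 + j ^+ 2 + (s + be) ^+ 2 + (be + 1) ^+ 2
    + 2 * (al * r) + 4 * (t * r * s) + 2 * (r' * j) + 2 * (r * j)); last ring.
  by rewrite !addr_ge0 ?sq // ?mulr_ge0 // ?mulr_ge0.
- have hd : 0 <= - r' - 1 by lia.
  have hc : 0 <= - j by lia.
  rewrite (ger0_norm hr) (ger0_norm hs) (ltr0_norm hj).
  rewrite [leRHS](_ : _ = (r + j) ^+ 2 + (s + be) ^+ 2 + (be + 1) ^+ 2
    + 2 * (al * r) + 4 * (t * r * s) + 2 * ((- r' - 1) * - j)); last ring.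
  by rewrite !addr_ge0 ?sq // ?mulr_ge0 // ?mulr_ge0.
- have ha : 0 <= - r by lia.
  have hb : 0 <= - s - 1 by lia.
  rewrite (ltr0_norm hr) (ltr0_norm hs) (ger0_norm hj).
  rewrite [leRHS](_ : _ = (r + j) ^+ 2 + (s + be + 1) ^+ 2 + be ^+ 2
    + 2 * (r' * j) + 4 * (t * - r * (- s - 1)) + 2 * (- r * (al + 2 * be - 1))); last ring.
  by rewrite !addr_ge0 ?sq // ?mulr_ge0 // ?mulr_ge0.
- have ha : 0 <= - r by lia.
  have hb : 0 <= - s - 1 by lia.
  have hd : 0 <= - r' - 1 by lia.
  have hc : 0 <= - j by lia.
  rewrite (ltr0_norm hr) (ltr0_norm hs) (ltr0_norm hj).
  rewrite [leRHS](_ : _ = r ^+ 2 + j ^+ 2 + (s + be + 1) ^+ 2 + be ^+ 2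
    + 4 * (t * - r * (- s - 1)) + 2 * (- r * (al + 2 * be - 1))
    + 2 * ((- r' - 1) * - j) + 2 * (- r * - j)); last ring.
  by rewrite !addr_ge0 ?sq // ?mulr_ge0 // ?mulr_ge0.
Qed.

(** The majorant is a product of geometric series in r, s, j and a Gaussian series in - r', whose
    exponent binz2 (- r') controls x^(- r'). *)
Lemma abs_summable_quadruple : abs_summable u.
Proof.
have z n : q ^ n != 0 by apply: expfz_neq0.
(* [quadruple_exponent] bounds twice the exponent, hence powers of a square root of |q|. *)
pose rho := sqrtC `|q|.
have rho0 : 0 < rho by rewrite sqrtC_gt0 normr_gt0.
have rho2 : `|q| = rho ^ (2 : int) by rewrite -exprnP sqrtCK.
have rho1 : rho < 1.
  by rewrite -[1](@sqrtC1 C) ltr_sqrtC ?nnegrE.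
have geo := abs_summable_geometric (ltW rho0) rho1.
have gauss : abs_summable (fun n : int => q ^ binz2 (- n) * x ^ (- n)).
  by apply: abs_summable_inj (@oppr_inj _) (abs_summable_gauss q0 q1 x0).
have := abs_summableZ (rho ^ (- (be ^+ 2 + (be + 1) ^+ 2)))
  (abs_summableM (abs_summableM geo geo) (abs_summableM gauss geo)).
apply: abs_summable_le => -[[r s] [r' j]]; rewrite /u /=.
have sgn (a b : int) : (sg2 a b = 0) \/
    ((0 <= a) && (0 <= b) || (a < 0) && (b < 0)) /\ `|sg2 a b| = 1.
  rewrite sg2E; case: andP => _; first by right; rewrite normr1.
  by case: andP => _; [right; rewrite normrN normr1 | left].
have [->|[h1 n1]] := sgn r s; first by rewrite !mul0r normr0.
have [->|[h2 n2]] := sgn r' j; first by rewrite mul0r mulr0 normr0.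
rewrite 2!normrM n1 mul1r [X in _ * X]normrM n2 mul1r /hecke_mono.
rewrite !normrM !normfXz !normrM normrN normr1 !exp1rz !mul1r normfV !normrX.
rewrite (ger0_norm (ltW rho0)) rho2.
have r0 : rho != 0 by rewrite gt_eqF.
have -> : rho ^ (2 : int) / `|x| = rho ^ (2 : int) * `|x|^-1 by [].
rewrite (expfzMl (rho ^ 2)) exprz_inv !exprz_exp !(exprnP rho).
have lhs (a b c d e f y : C) : a * b * c * (d * y * e * f) = a * b * c * d * e * f * y by ring.
have rhs (a b c d e y : C) : a * (b * c * (d * y * e)) = a * b * c * d * e * y by ring.
rewrite lhs rhs ler_wpM2r ?exprz_ge0 // -!(expfzDr _ _ r0) ler_iXz2l ?(ltW rho1) //.
have := quadruple_exponent h1 h2; rewrite -!abszE.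
set lo := (X in X <= _); set hi := (X in _ <= X) => h.
rewrite [leLHS](_ : _ = lo) ?[leRHS](_ : _ = hi) //; first by rewrite /hi; ring.
by rewrite /lo; ring.
Qed.

Lemma g_expoE (r s : int) :
  g_expo t m r s = binz2 r + 2 * t * r * s + binz2 s + (1 + al) * r + (1 + be) * s.
Proof.
rewrite /g_expo -[RHS](@mulKz _ 2) //; congr (_ %/ _)%Z.
by rewrite !mulrDr !binz2E; ring.
Qed.

Lemma g_termE (r s : int) :
  hecke_mono 1 (2 * t) 1 (q ^ (1 + al)) (q ^ (1 + be)) q r s *
    hecke_f 1 1 1 (q / x) (q ^ (1 + r)) q = Theta x q * g_term t m x q r s.
Proof.
rewrite hecke_f111 /g_term g_expoE /hecke_mono !mul1r !exprz_exp !(expfzDr _ _ q0).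
by ring.
Qed.

Let restrict (P : pred (int * int)) (w : (int * int) * (int * int)) : C :=
  if P w.1 then u w else 0.

(** [hecke_g] is a difference of two separate unordered sums, so each quadrant has to be summed on
    its own before they are joined. *)
Lemma has_sum_restrict (P : pred (int * int)) : exists S, has_sum (restrict P) S /\
  has_sum (fun p : int * int =>
    if P p then sg2 p.1 p.2 * g_term t m x q p.1 p.2 else 0) (S / Theta x q).
Proof.
have : abs_summable (restrict P).
  apply: abs_summable_le abs_summable_quadruple => w.
  by rewrite /restrict; case: ifP; rewrite ?normr0.
move=> /abs_summable_has_sum[S hS]; exists S; split=> //.
have X0 : q / x != 0 by rewrite mulf_neq0 ?invr_eq0.
have th := Theta_neq0 q0 q1 x0 xq.
have : has_sum (fun p : int * int => Theta x q *
    if P p then sg2 p.1 p.2 * g_term t m x q p.1 p.2 else 0) S.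
  apply: has_sum_rows hS _ => -[r s]; rewrite /restrict /=; case: ifP => _; last first.
    by rewrite mulr0; apply: has_sum0.
  have := has_sumZ
      (sg2 r s * hecke_mono 1 (2 * t) 1 (q ^ (1 + al)) (q ^ (1 + be)) q r s)
    (hecke_fP q0 q1 ltr01 ler01 ltr01 X0 (expfz_neq0 (1 + r) q0)).
  rewrite -[_ * hecke_f _ _ _ _ _ _]mulrA g_termE [X in has_sum _ X -> _]mulrCA.
  exact: eq_has_sum.
move=> /(has_sumZ (Theta x q)^-1); rewrite mulrC.
by apply: eq_has_sum => p; rewrite mulKf.
Qed.

Lemma has_sum_hecke_g : has_sum u (Theta x q * hecke_g t m x q).
Proof.
pose pos (p : int * int) := (0 <= p.1) && (0 <= p.2).
pose neg (p : int * int) := (p.1 < 0) && (p.2 < 0).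
have [Sp [hp gp]] := has_sum_restrict pos.
have [Sn [hn gn]] := has_sum_restrict neg.
have th := Theta_neq0 q0 q1 x0 xq.
have e1 : sum_ZZ (fun r s => if (0 <= r) && (0 <= s) then g_term t m x q r s else 0)
    = Sp / Theta x q.
  apply: has_sum_sum; apply: eq_has_sum gp => -[r s] /=; rewrite /pos /=.
  by case: ifP => // /andP[r0 s0]; rewrite sg2_nneg // mul1r.
have e2 : sum_ZZ (fun r s => if (r < 0) && (s < 0) then g_term t m x q r s else 0)
    = - (Sn / Theta x q).
  apply: has_sum_sum; have := has_sumZ (-1) gn; rewrite mulN1r; apply: eq_has_sum => -[r s] /=.
  rewrite /neg /=; case: ifP => [/andP[r0 s0]|_]; last by rewrite mulr0.
  by rewrite sg2_neg // !mulN1r opprK.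
rewrite /hecke_g e1 e2 opprK -mulrDl mulrC divfK //.
apply: eq_has_sum (has_sumD hp hn) => -[[r s] w]; rewrite /restrict /pos /neg /=.
(* On the mixed quadrants both restrictions vanish, and [u] vanishes through [sg2]. *)
case: (leP 0 r) => r0; case: (leP 0 s) => s0 /=; rewrite ?addr0 ?add0r //.
- by rewrite /u /= sg2_mixed ?mul0r // r0 leNgt s0.
- by rewrite /u /= sg2_mixed ?mul0r // s0 leNgt r0.
Qed.

(** The coupling q^(r j) can be read in either factor: it moves from (q^(1 + r))^j to (q^(1 + al +
    j))^r. *)
Lemma has_sum_dual : has_sum (fun p : int * int =>
    sg2 p.1 p.2 * hecke_mono 1 1 1 (q / x) q q p.1 p.2 *
      hecke_f 1 (2 * t) 1 (q ^ (1 + al + p.2)) (q ^ (1 + be)) q)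
  (Theta x q * hecke_g t m x q).
Proof.
pose sw (w : (int * int) * (int * int)) := (w.2, w.1).
have sK : cancel sw sw by case.
have b0 : 0 <= 2 * t by rewrite mulr_ge0 // (le_trans ler01).
have z n : q ^ n != 0 by apply: expfz_neq0.
apply: has_sum_rows (has_sum_bij sK sK has_sum_hecke_g) _ => -[r' j].
apply: eq_has_sum (has_sumZ _ (hecke_fP q0 q1 ltr01 b0 ltr01 (z _) (z _))) => -[r s].
have swap (a b c d c' d' : C) : c * d = c' * d' -> a * c * (b * d) = b * d' * (a * c').
  by move=> e; rewrite mulrACA e; ring.
apply: swap; rewrite /hecke_mono /=.
have -> : (q ^ (1 + al + j)) ^ r = (q ^ (1 + al)) ^ r * q ^ (j * r).
  by rewrite !exprz_exp -expfzDr //; congr (_ ^ _); ring.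
have -> : (q ^ (1 + r)) ^ j = q ^ j * q ^ (j * r).
  by rewrite !exprz_exp -expfzDr //; congr (_ ^ _); ring.
by ring.
Qed.

End Appell.

(** * Regrouping by residues modulo 4t^2 - 1 *)

Section Assembly.
Variables (R : realType) (q : R[i]).
Hypotheses (q0 : q != 0) (q1 : `|q| < 1).
Local Notation C := R[i].
Local Notation sg2 := (@sg2 R).
Variable x : C.
Hypotheses (x0 : x != 0) (xq : forall n : int, x != q ^ n).
Variables (al be : int).
Hypotheses (al0 : 0 <= al) (albe : 1 <= al + be) (al2be : 1 <= al + 2 * be).
Local Notation t := (al + be).
Local Notation m := (al - be).
Local Notation M := (4 * t ^+ 2 - 1).

(** Euclidean division with nonnegative remainder keeps signs: k + n s is negative exactly when s
    is. *)
Lemma sg2_divmod (r s k n : int) : 0 <= k < n -> sg2 r (k + n * s) = sg2 r s.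
Proof.
case/andP=> k0 kn; rewrite /Defs.sg2 /sg.
have -> // : (0 <= k + n * s) = (0 <= s).
by case: (leP 0 s) => s0; [apply/idP; nia | apply/negbTE; rewrite -ltNge; nia].
Qed.

(* Here n = s + 1 shifts by (1, - 2t) bring the argument back to the range 0 <= k < 4t^2 - 1. *)
Lemma hecke_terms_match (r s k : int) :
  hecke_mono 1 1 1 (q / x) q q r (k + M * s) *
    hecke_f 1 (2 * t) 1 (q ^ (1 + al + (k + M * s))) (q ^ (1 + be)) q =
  q ^ (1 - 3 * t ^+ 2 - be + t * m) * ((-1) ^ (k + 1) * q ^ (binz2 (k + 1) + k) *
    hecke_f 1 (2 * t) 1 (q ^ (2 - 4 * t ^+ 2 + al + k)) (q ^ (1 + be)) q) *
  hecke_mono 1 M (4 * t ^+ 2 * M) (x^-1 * q ^ (k + 1))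
    (- q ^ (4 * t ^+ 2 * k - t ^+ 2 + t * m - be + 8 * t ^+ 4)) q r s.
Proof.
have b0 : 0 <= 2 * t by rewrite mulr_ge0 // (le_trans ler01).
rewrite (hecke_f_shift q0 q1 _ _ (s + 1) (- (2 * t * (s + 1))) b0).
(* A shift by s alone would leave 1 + al + k; the additional unit lowers it by M, which gives the 2
   - 4t^2 of the statement. *)
have -> : 1 + al + (k + M * s) + (s + 1) + 2 * t * - (2 * t * (s + 1))
  = 2 - 4 * t ^+ 2 + al + k by ring.
have -> : 1 + be + 2 * t * (s + 1) - 2 * t * (s + 1) = 1 + be by ring.
set F := hecke_f _ _ _ _ _ _.
have reorg (a b c d e : C) : a * b = c * d * e -> a * (b * F) = c * (d * F) * e.
  by move=> h; rewrite mulrA h; ring.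
apply: reorg; rewrite /hecke_mono.
rewrite [(q / x) ^ r]expfzMl [(x^-1 * _) ^ r]expfzMl [(- _) ^ s]expNrz !exprz_exp.
have n1 : (-1 : C) != 0 by rewrite oppr_eq0 oner_eq0.
have split_factors (a b c d e f g h a' b' c' d' e' f' g' h' y : C) :
    a * e = b' * d' * f' -> b * c * d * f * g * h = a' * c' * e' * g' * h' ->
    a * (b * y) * c * d * (e * f * g * h) =
    a' * (b' * c') * (d' * (y * e') * (f' * g') * h').
  move=> e1 e2; transitivity ((a * e) * y * (b * c * d * f * g * h)); first by ring.
  by rewrite e1 e2; ring.
apply: split_factors.
  rewrite -!(expfzDr _ _ n1).
  (* The lone s is the sign of the argument - q^(...) raised to the power s; the rest is even. *)
  have -> : r + (k + M * s) + (s + 1 - 2 * t * (s + 1)) =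
    k + 1 + (r + s) + s + 2 * (2 * t ^+ 2 * s - t * (s + 1) - s) by ring.
  exact: exprN1_even.
rewrite -!(expfzDr _ _ q0).
(* Doubling clears the binomials and leaves a polynomial identity. *)
congr (_ ^ _); apply: (@mulfI _ (2 : int)) => //; rewrite !mulrDr.
have E (c n : int) : 2 * (c * binz2 n) = c * (n * (n - 1)) by rewrite mulrCA binz2E.
by rewrite !E !binz2E; ring.
Qed.

Lemma Theta_mul_hecke_g : Theta x q * hecke_g t m x q =
  q ^ (1 - 3 * t ^+ 2 - be + t * m) * \sum_(0 <= k < absz M)
    ((-1) ^+ k.+1 * q ^ (binz2 (k%:Z + 1) + k%:Z)
     * hecke_f 1 (2 * t) 1 (q ^ (2 - 4 * t ^+ 2 + al + k%:Z)) (q ^ (1 + be)) q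
     * hecke_f 1 M (4 * t ^+ 2 * M) (x^-1 * q ^ (k%:Z + 1))
         (- q ^ (4 * t ^+ 2 * k%:Z - t ^+ 2 + t * m - be + 8 * t ^+ 4)) q).
Proof.
have M0 : 0 < M by nia.
have MN : (absz M)%:Z = M by rewrite gez0_abs // ltW.
have modM (j : int) : (absz (j %% M)%Z < absz M)%N.
  by rewrite -ltz_nat gez0_abs ?modz_ge0 ?gt_eqF // MN ltz_pmod.
(* Euclidean division of j by M, with the residue in a finite type: as row index it turns
   [has_sum_rows] into a finite sum over k. *)
pose f (w : 'I_(absz M) * (int * int)) := (w.2.1, (w.1 : nat)%:Z + M * w.2.2).
pose g (p : int * int) := (Ordinal (modM p.2), (p.1, (p.2 %/ M)%Z)).
have fg : cancel f g.
  case=> k [r s]; have kM : 0 <= (k : nat)%:Z < `|M|%:Z by rewrite ltz_nat ltn_ord.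
  rewrite /f /g /=; congr (_, (_, _)).
    apply: val_inj => /=; rewrite addrC mulrC modzMDl modz_small ?absz_nat //.
    by rewrite -[X in _ < X]MN.
  by rewrite addrC mulrC divzMDl ?gt_eqF // divz_small ?addr0.
have gf : cancel g f.
  case=> r j; rewrite /f /g /=; congr (_, _).
  by rewrite gez0_abs ?modz_ge0 ?gt_eqF // addrC mulrC -divz_eq.
have X0 (k : int) : x^-1 * q ^ k != 0 by rewrite mulf_neq0 ?invr_eq0 ?expfz_neq0.
have Y0 (k : int) : - q ^ k != 0 by rewrite oppr_eq0 expfz_neq0.
have c0 : 0 < 4 * t ^+ 2 * M by rewrite mulr_gt0 // mulr_gt0 // exprn_gt0 // (lt_le_trans ltr01).
have := has_sum_bij fg gf (has_sum_dual q0 q1 x0 xq al0 albe al2be).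
move=> /has_sum_rows h; rewrite big_mkord mulr_sumr.
apply: has_sum_unique (h _ _) (has_sum_fin _) => k.
have -> : (-1 : C) ^+ k.+1 = (-1) ^ (k%:Z + 1) by rewrite exprnP -addn1 PoszD.
rewrite [X in has_sum _ X]mulrA.
apply: eq_has_sum (has_sumZ _ (hecke_fP q0 q1 ltr01 (ltW M0) c0 (X0 _) (Y0 _))) => -[r s].
rewrite /f /= sg2_divmod; last by rewrite -[X in _ < X]MN /= ltz_nat ltn_ord.
by rewrite -[RHS]mulrA hecke_terms_match [LHS]mulrCA.
Qed.

End Assembly.

Theorem theorem1p1 (R : realType) (q : R[i]) (t m : int) (x : R[i])
    (hq0 : q != 0) (hq1 : `|q| < 1)
    (ht : 1 <= t) (hmt : - t <= m) (hm3t : m <= 3 * t - 2)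
    (htm : (t = m %[mod 2])%Z)
    (hx0 : x != 0) (hxq : forall n : int, x != q ^ n) :
  calU t m x q =
    (1 - x) / Theta x q
    * (q ^ (1 - 3 * t ^+ 2 - ((t - m) %/ 2)%Z + t * m) / qpoch_inf q q ^+ 2)
    * \sum_(0 <= k < absz (4 * t ^+ 2 - 1)%R)
        ((-1) ^+ k.+1 * q ^ (binz2 (k%:Z + 1) + k%:Z)
         * hecke_f 1 (2 * t) 1
             (q ^ (2 - 4 * t ^+ 2 + ((t + m) %/ 2)%Z + k%:Z))
             (q ^ (1 + ((t - m) %/ 2)%Z))
             q
         * hecke_f 1 (4 * t ^+ 2 - 1) (4 * t ^+ 2 * (4 * t ^+ 2 - 1))
             (x^-1 * q ^ (k%:Z + 1))
             (- q ^ (4 * t ^+ 2 * k%:Z - t ^+ 2 + t * m - ((t - m) %/ 2)%Z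
                     + 8 * t ^+ 4))
             q).
Proof.
set al := ((t + m) %/ 2)%Z; set be := ((t - m) %/ 2)%Z.
(* The congruence modulo 2 makes both quotients exact. *)
have tE : t = al + be by rewrite /al /be; lia.
have mE : m = al - be by rewrite /al /be; lia.
move: al be tE mE => al be tE mE; subst t m.
have al0 : 0 <= al by lia.
have al2be : 1 <= al + 2 * be by lia.
have th := Theta_neq0 hq0 hq1 hx0 hxq.
have E := Theta_mul_hecke_g hq0 hq1 hx0 hxq al0 ht al2be.
have gE : hecke_g (al + be) (al - be) x q =
  (Theta x q)^-1 * (Theta x q * hecke_g (al + be) (al - be) x q) by rewrite mulKf.
rewrite /calU gE E; set S := \sum_(0 <= k < _) _.
by ring.
Qed.
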